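(* Let $Y$ be a locally compact Polish group, let $\mu$ be a left (resp. right) Haar measure on $Y$, let $\Gamma$ be as in the context, and assume that left (resp. right) translation of paths defines an action of $Y$ on $\Gamma$, i.e. $l_y(\Gamma)=\Gamma$ (resp. $r_y(\Gamma)=\Gamma$) for every $y\in Y$, where $l_y(\gamma)(t)=y\cdot\gamma(t)$ and $r_y(\gamma)(t)=\gamma(t)\cdot y$. Let $\eta$ be a positive Radon measure on $\Gamma$ such that $(e_t)_\#\eta=\mu$ for every $t\in\mathbb{R}$. Assume that $\eta$ is left invariant, i.e. $(l_y)_\#\eta=\eta$ for every $y\in Y$ (resp. right invariant, i.e. $(r_y)_\#\eta=\eta$ for every $y\in Y$). Then $\eta$ is Markov regular.
   Context: Setting. $C(\mathbb{R};Y)$ is the set of continuous maps $\mathbb{R}\to Y$ with the topology of uniform convergence on compacts. For $t\in\mathbb{R}$, $e_t(\gamma)=\gamma(t)$; for $h\in\mathbb{R}$, $b_h(\gamma)=\gamma(\cdot-h)$. $\Gamma\subset C(\mathbb{R};Y)$ is a locally compact Polish subspace such that: (i) for each compact interval $I\subset\mathbb{R}$ and compact $K\subset Y$, the set $\{\gamma\in\Gamma:\gamma(t)\in K\text{ for some }t\in I\}$ is compact in $\Gamma$; (ii) $b_h(\Gamma)=\Gamma$ for every $h\in\mathbb{R}$. Measures. $\mathcal{M}(\Gamma)$ is the set of positive Radon measures on $\Gamma$ with the vague (weak-star) topology (coarsest topology making $\nu\mapsto\int\Phi\,d\nu$ continuous for all $\Phi\in C_c(\Gamma)$); $\mathcal{P}(\Gamma)\subset\mathcal{M}(\Gamma)$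 is the set of probability measures, with the induced topology (and the uniformity given by the pseudometrics $|\int\Phi\,d\nu^1-\int\Phi\,d\nu^2|$, $\Phi\in C_c(\Gamma)$). $\mathcal{M}_\mu(\Gamma)$ is the set of $\eta\in\mathcal{M}(\Gamma)$ with $(e_t)_\#\eta=\mu$ for all $t\in\mathbb{R}$. A disintegration of $\eta\in\mathcal{M}_\mu(\Gamma)$ with respect to $e_t$ and $\mu$ is a Borel family $\{\eta_{t,x}\}_{x\in\operatorname{supp}\mu}\subset\mathcal{P}(\Gamma)$ with $\eta_{t,x}(\{\gamma:\gamma(t)=x\})=1$ for every $x$ and $\eta=\int\eta_{t,x}\,\mu(dx)$; it is unique up to $\mu$-null sets of $x$. Markovianisation. For an interval $I$, $\Gamma\lfloor_I$ is the set of restrictions to $I$ of elements of $\Gamma$, with the final topology for the restriction map $r^I:\Gamma\to\Gamma\lfloor_I$; for $\nu\in\mathcal{P}(\Gamma)$, $\nu^I:=(r^I)_\#\nu$. If $\nu_1,\nu_2$ are Borel probability measures on $\Gamma\lfloor_{(-\infty,t]}$ and $\Gamma\lfloor_{[t,+\infty)}$, each concentrated on paths with value $x$ at time $t$, then $\nu_1\otimes_{(t,x)}\nu_2$ is the unique Borel probability measure on $\Gamma$ whose pushforward under $\gamma\mapsto(\gamma\lfloor_{(-\infty,t]},\gamma\lfloor_{[t,+\infty)})$ is $\nu_1\times\nu_2$. For $\eta\in\mathcal{M}_\mu(\Gamma)$, $$M_t(\eta)=\int_Y\eta_{t,x}^{(-\infty,t]}\otimes_{(t,x)}\eta_{t,x}^{[t,+\infty)}\,\mu(dx)\in\mathcal{M}_\mu(\Gamma).$$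 For a finite set $F=\{t_1,\dots,t_n\}\subset\mathbb{R}$, $M_F(\eta)=(M_{t_n}\circ\cdots\circ M_{t_1})(\eta)$, which does not depend on the ordering of $F$. $\mathcal{X}_\mu$ is the set of families $\{\nu_x\}_{x\in\operatorname{supp}\mu}\subset\mathcal{P}(\Gamma)$ such that $x\mapsto\nu_x$ is continuous on $\operatorname{supp}\mu$ and there exists $t\in\mathbb{R}$ such that $\operatorname{supp}\nu_x\subset\{\gamma:\gamma(t)=x\}$ for every $x\in\operatorname{supp}\mu$; it carries the topology of uniform convergence on compact subsets of $\operatorname{supp}\mu$ of maps into $\mathcal{P}(\Gamma)$. Markov regular. $\eta\in\mathcal{M}_\mu(\Gamma)$ is Markov regular if for every compact $I\subset\mathbb{R}$ there is a compact $K\subset\mathcal{X}_\mu$ such that for every finite $F\subset\mathbb{R}$ and every $t\in I$ there is a disintegration of $M_F(\eta)$ with respect to $e_t$ and $\mu$ belonging to $K$. *)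

(* Defs.v *)
From HB Require Import structures.
From mathcomp Require Import all_boot all_order all_algebra finmap.
From mathcomp Require Import all_classical all_reals all_analysis measurable_realfun.

Set Implicit Arguments.
Unset Strict Implicit.
Unset Printing Implicit Defensive.

Import Order.TTheory GRing.Theory Num.Theory.
Import numFieldNormedType.Exports.

Local Open Scope classical_set_scope.
Local Open Scope ring_scope.

HB.mixin Record isTopologicalGroup G & Group G & Topological G := {
  mulg_continuous : continuous (fun xy : G * G => (xy.1 * xy.2)%g) ;
  invg_continuous : continuous (fun x : G => x^-1%g)
}.

(* Only the topology of a topological group matters below. The uniform
   structure is any one inducing it (no relation with the group law is
   required); it is used to speak of uniform convergence on compacts in
   C(R; Y), whose topology does not depend on that choice. *)
#[short(type="topologicalGroupType")]
HB.structure Definition TopologicalGroup :=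
  {G of Group G & Uniform G & isTopologicalGroup G}.

Definition complete_metric (R : realType) (T : topologicalType)
    (d : T -> T -> R) : Prop :=
  [/\ (forall x y, d x y = 0 <-> x = y),
      (forall x y, d x y = d y x),
      (forall x y z, d x z <= d x y + d y z),
      (forall (x : T) (A : set T),
        nbhs x A <-> exists2 e, 0 < e & [set y | d x y < e] `<=` A) &
      (forall u : nat -> T,
        (forall e, 0 < e -> exists N, forall m n, (N <= m)%N -> (N <= n)%N ->
          d (u m) (u n) < e) ->
        exists l : T, u @ \oo --> l)].

Definition polish (R : realType) (T : topologicalType) : Prop :=
  (exists2 D : set T, countable D & dense D) /\
  (exists d : T -> T -> R, complete_metric d).

(* Measurable types are pointed in the library: the point x0 has no other
   role than to witness that the space is inhabited. *)
Definition pointed_at (T : topologicalType) (x0 : T) : Type := T.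

HB.instance Definition _ (T : topologicalType) (x0 : T) :=
  Topological.on (pointed_at x0).
HB.instance Definition _ (T : topologicalType) (x0 : T) :=
  isPointed.Build (pointed_at x0) x0.

Notation borel x0 := (g_sigma_algebraType (@open (pointed_at x0))).

Section measures.
Context (R : realType) (T : topologicalType) (x0 : T).
Implicit Types m : set (borel x0) -> \bar R.

Definition radon m : Prop :=
  (forall K : set T, compact K -> (m K < +oo)%E) /\
  (forall A : set (borel x0), measurable A ->
    m A = ereal_sup [set m K | K in [set K : set T | compact K /\ K `<=` A]]).

Definition msupp m : set T :=
  [set x | forall U : set T, open U -> U x -> (0 < m U)%E].

Definition Cc : set (T -> R) :=
  [set Phi | continuous Phi /\ compact (closure [set x | Phi x != 0])].

Definition vague_eval (nu : probability (borel x0) R) : {ptws Cc -> R} :=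
  fun Phi => \int[nu]_x (val Phi x).

(* The Borel probability measures, with the uniformity of the pseudometrics
   |\int Phi dnu1 - \int Phi dnu2| for Phi in Cc. *)
Definition vague_probability : Type := probability (borel x0) R.
Identity Coercion vague_probability_coercion : vague_probability >-> probability.

HB.instance Definition _ :=
  Uniform.copy vague_probability (initial_topology vague_eval).

End measures.
Arguments vague_probability R {T} x0.
Arguments Cc R T : clear implicits.

Notation paths R Y := {family (@compact R%type), R%type -> Y%type}.

Section paths.
Context (R : realType) (Y : topologicalGroupType).
Implicit Types (t h : R) (y : Y) (gam : paths R Y).

Definition time_shift h gam : paths R Y := fun t => gam (t - h).
Definition left_translate y gam : paths R Y := fun t => (y * gam t)%g.
Definition right_translate y gam : paths R Y := fun t => (gam t * y)%g.

(* The standing assumptions on Gam; the type of its elements, written Gam,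
   has the subspace topology. *)
Definition path_space (Gam : set (paths R Y)) : Prop :=
  [/\ (forall gam, Gam gam -> continuous (gam : R -> Y)),
      locally_compact [set: Gam],
      polish R Gam,
      (forall (a b : R) (K : set Y), compact K ->
        compact [set gam : Gam | exists2 t, a <= t <= b & K (val gam t)]) &
      (forall h, time_shift h @` Gam = Gam)].

End paths.

(* The map induced on Gam by a map that preserves it. *)
Lemma induced_map_subproof (T : Type) (Gam : set T) (f : T -> T)
  (fGam : f @` Gam = Gam) (gam : Gam) : f (val gam) \in Gam.
Proof.
apply/mem_set; suff: (f @` Gam) (f (val gam)) by rewrite {1}fGam.
by exists (val gam); [exact: set_valP|].
Qed.

Definition induced_map (T : Type) (Gam : set T) (f : T -> T)
  (fGam : f @` Gam = Gam) (gam : Gam) : Gam :=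
  exist _ (f (val gam)) (induced_map_subproof fGam gam).

Section restrictions.
Context (R : realType) (Y : topologicalGroupType).
Context (Gam : set (paths R Y)) (I : set R).

Definition restriction (gam : Gam) : I -> Y := fun s => val gam (val s).

Definition restricted : Type := range restriction.

HB.instance Definition _ := gen_eqMixin restricted.
HB.instance Definition _ := gen_choiceMixin restricted.

Definition restrict_path (gam : Gam) : restricted :=
  exist _ (restriction gam) (mem_set (imageT restriction gam)).

Definition final_open : set_system restricted :=
  [set A | open (restrict_path @^-1` A)].

Let final_openT : final_open setT.
Proof. exact: openT. Qed.

Let final_openI : setI_closed final_open.
Proof. by move=> A B; exact: openI. Qed.

Let final_open_bigU (J : Type) (f : J -> set restricted) :
  (forall i, final_open (f i)) -> final_open (\bigcup_i f i).
Proof.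
move=> fo; rewrite /final_open /= preimage_bigcup.
by apply: bigcup_open => i _; exact: fo.
Qed.

HB.instance Definition _ := isOpenTopological.Build restricted
  final_openT final_openI final_open_bigU.

End restrictions.

Section markov.
Context (R : realType) (Y : topologicalGroupType).
Context (mu : {measure set (borel (1%g : Y)) -> \bar R}).
Context (Gam : set (paths R Y)) (gam0 : Gam).
Implicit Types (t : R) (eta zeta : {measure set (borel gam0) -> \bar R}).

Definition evalt t : borel gam0 -> borel (1%g : Y) := fun gam => val gam t.

Definition Mmu eta : Prop :=
  radon eta /\
  forall t (B : set (borel (1%g : Y))), measurable B ->
    pushforward eta (evalt t) B = mu B.

(* Families indexed by supp mu are represented by total functions on Y of
   which only the values on supp mu are used; in particular the topology
   below on such functions does not separate two functions that agree on
   supp mu. *)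
Definition mu_family : Type :=
  {family (compactly_in (msupp mu)), Y -> vague_probability R gam0}.
Implicit Types kappa nu : Y -> vague_probability R gam0.

Definition borel_family kappa : Prop :=
  forall A : set (borel gam0), measurable A ->
    measurable_fun (msupp mu : set (borel (1%g : Y)))
      (fun x => kappa x A).

(* eta = \int kappa_x mu(dx) *)
Definition mixture kappa eta : Prop :=
  forall A : set (borel gam0), measurable A ->
    eta A = (\int[mu]_(x in msupp mu) kappa x A)%E.

Definition disintegration t eta kappa : Prop :=
  [/\ borel_family kappa,
      (forall x, msupp mu x ->
        kappa x [set gam | val gam t = x] = 1%E) &
      mixture kappa eta].

Definition past t : set R := [set` `]-oo, t]].
Definition future t : set R := [set` `[t, +oo[].

Definition restrict_borel (I : set R) :
  borel gam0 -> borel (restrict_path I gam0) := @restrict_path R Y Gam I.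

Definition past_future t (gam : borel gam0) :
    borel (restrict_path (past t) gam0) * borel (restrict_path (future t) gam0) :=
  (restrict_borel (past t) gam, restrict_borel (future t) gam).

(* p is the product nu^(past) (x)_(t,x) nu^(future), where nu is concentrated on
   the paths with value x at time t. *)
Definition concatenation t (nu p : probability (borel gam0) R) : Prop :=
  forall A : set (borel (restrict_path (past t) gam0) *
                  borel (restrict_path (future t) gam0)), measurable A ->
    pushforward p (past_future t) A =
    (pushforward nu (restrict_borel (past t)) \x
     pushforward nu (restrict_borel (future t)))%E A.

Definition is_markovianisation t eta zeta : Prop :=
  exists kappa nu,
    [/\ disintegration t eta kappa,
        borel_family nu,
        (forall x, msupp mu x -> concatenation t (kappa x) (nu x)) &
        mixture nu zeta].

(* M_t as a total map: M_t(eta) is the measure characterized by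
   is_markovianisation (unique on Borel sets). If there is none (for eta in
   M_mu, this means that the concatenations leave Gam), M_t(eta) is eta by
   convention. *)
Definition markovianisation t eta : {measure set (borel gam0) -> \bar R} :=
  match pselect (exists zeta, is_markovianisation t eta zeta) with
  | left ex_zeta => projT1 (cid ex_zeta)
  | right _ => eta
  end.

(* M_(t_n) o ... o M_(t_1) for the enumeration t_1, ..., t_n of F; the
   result does not depend on the enumeration. *)
Definition markovianisations (F : {fset R}) eta :=
  foldl (fun zeta t => markovianisation t zeta) eta (enum_fset F).

Definition Xmu : set mu_family :=
  [set nu | {within msupp mu, continuous (nu : Y -> vague_probability R gam0)} /\
    exists t, forall x, msupp mu x ->
      msupp (nu x) `<=`
        [set gam : Gam | val gam t = x]].

Definition markov_regular eta : Prop :=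
  forall I : set R, compact I ->
    exists K : set mu_family, [/\ compact K, K `<=` Xmu &
      forall (F : {fset R}) t, I t ->
        exists2 kappa, K kappa & disintegration t (markovianisations F eta) kappa].

End markov.

Section haar.
Context (R : realType) (Y : topologicalGroupType).
Implicit Type mu : {measure set (borel (1%g : Y)) -> \bar R}.

Definition left_haar mu : Prop :=
  [/\ radon mu, mu setT != 0%E &
      forall (y : Y) (B : set (borel (1%g : Y))), measurable B ->
        mu [set (y * x)%g | x in (B : set Y)] = mu B].

Definition right_haar mu : Prop :=
  [/\ radon mu, mu setT != 0%E &
      forall (y : Y) (B : set (borel (1%g : Y))), measurable B ->
        mu [set (x * y)%g | x in (B : set Y)] = mu B].

End haar.

Definition invariant_measure (R : realType) (T : topologicalType) (x0 : T)
    (eta : {measure set (borel x0) -> \bar R}) (f : T -> T) : Prop :=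
  forall A : set (borel x0), measurable A ->
    pushforward eta (f : borel x0 -> borel x0) A = eta A.

(* Main.v *)
(* By uniqueness of Haar measure, a left invariant measure zeta on Gam with
   marginals mu is the mixture of the translates (l_x)_# nu, x in Y, of one
   probability measure nu concentrated on the paths that are at 1 at time t. If
   (kappa_x) is a disintegration of zeta, then for every event P one has
   kappa_x(P) = nu(l_x^-1 P) for almost every x, so the Markovianisation M_t(zeta)
   is again left invariant: on the pi-system of intersections of an event before
   t and an event after t it is an integral of products nu(l_x^-1 P) nu(l_x^-1 F).
   By induction all M_F(eta) are left invariant, so all the disintegrations to be
   controlled have the form x |-> (l_x)_# nu with nu concentrated on the paths
   that are at 1 at some time t of the compact set I. These paths lie in a compact
   subset of Gam, hence the set of such nu is vaguely compact, and so is its image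
   under the continuous map nu |-> (x |-> (l_x)_# nu) into X_mu. *)
Require Import Defs.
From HB Require Import structures.
From mathcomp Require Import all_boot all_order all_algebra finmap.
From mathcomp Require Import all_classical all_reals all_analysis measurable_realfun.
From mathcomp Require Import ring lra.

Set Implicit Arguments.
Unset Strict Implicit.
Unset Printing Implicit Defensive.

Import Order.TTheory GRing.Theory Num.Theory.
Import numFieldNormedType.Exports.

Local Open Scope classical_set_scope.
Local Open Scope ring_scope.

(** * Second countable and Polish spaces *)

(** Three points shape the proof beyond this outline. First, the measures may have infinite mass, so
    uniqueness of Haar measure and the pi-system argument both rest on [Y] being a countable union
    of open sets of finite [mu]-measure. Second, the identity between a disintegration and a
    translate holds outside a null set that depends on the event. No common null set is sought:
    invariance of the Markovianisation is checked on one pair of events at a time, under the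
    integral over [x]. Third, vague limits may lose mass; this cannot happen here because all the
    measures to be controlled are carried by one compact set. The limit itself is built along an
    ultrafilter: the limits of the masses are only finitely additive, and a measure is rebuilt from
    their values on compact sets. The pinning time varies with the measure, so it has to converge
    along the ultrafilter as well. *)

Section countable_base.
Context (T : topologicalType).
Hypothesis scT : @second_countable T.

(** For each code [n] of a base element, one [W] in [S] is picked that contains this element and
    lies in [O], or [set0] if there is none. A family indexed by points is thus replaced by a
    countable one. *)
Lemma second_countable_bigcup (S : set (set T)) (O : set T) : S set0 ->
  (forall x, O x -> exists W, [/\ S W, nbhs x W & W `<=` O]) ->
  exists2 F : (set T)^nat, (forall n, S (F n)) & O = \bigcup_n F n.
Proof.
move=> S0 SO; have [B cB [oB nB]] := scT.
have /countable_injP[f fi] := cB.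
pose Q n := [set W | [/\ S W, W `<=` O & exists b, [/\ B b, f b = n & b `<=` W]]].
pose F n := xget set0 (Q n).
have FQ n : F n = set0 \/ Q n (F n) by rewrite /F; case: xgetP => //; [right|left].
exists F; first by move=> n; case: (FQ n) => [->//|[]].
apply/seteqP; split=> [x Ox|x [n _]]; last first.
  by case: (FQ n) => [->//|[_ FO _]] /FO.
have [W [SW /nB [b [Bb bx] bW] WO]] := SO x Ox.
exists (f b) => //.
have [_ _ [b' [Bb' fb' b'F]]] : Q (f b) (F (f b)).
  by apply: (@xgetPex _ set0 (Q (f b))); exists W; split=> //; exists b.
by apply: b'F; rewrite (fi b' b) ?inE.
Qed.

(** Lindelof property in the form used below, where [S] is a product sigma-algebra, the cylinder
    sigma-algebra or the class of null Borel sets; the pieces [W] need not be open. *)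
Lemma second_countable_locally (S : set (set T)) (O : set T) :
  S set0 -> (forall F : (set T)^nat, (forall n, S (F n)) -> S (\bigcup_n F n)) ->
  (forall x, O x -> exists W, [/\ S W, nbhs x W & W `<=` O]) -> S O.
Proof. by move=> S0 SU /(second_countable_bigcup S0)[F SF ->]; exact: SU. Qed.

End countable_base.

Lemma second_countable_prod (T1 T2 : topologicalType) :
  @second_countable T1 -> @second_countable T2 ->
  @second_countable (T1 * T2)%type.
Proof.
move=> [B1 cB1 [oB1 nB1]] [B2 cB2 [oB2 nB2]].
exists [set p.1 `*` p.2 | p in B1 `*` B2].
  exact/(card_le_trans (card_image_le _ _))/countableX.
split=> [_ [[b1 b2] [/= ? ?] <-]|[x1 x2] W [[/= U V] [U1 V2] UVW]].
  rewrite openE => -[x1 x2] [/= b1x b2x]; exists (b1, b2) => //=.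
  by split; apply: open_nbhs_nbhs; split => //; [exact: oB1|exact: oB2].
have [b1 [Bb1 bx1] bU] := nB1 _ _ U1; have [b2 [Bb2 bx2] bV] := nB2 _ _ V2.
exists (b1 `*` b2); first by split=> //; exists (b1, b2).
by apply: subset_trans UVW => -[y1 y2] [/= /bU ? /bV ?].
Qed.

Section polish.
Context (R : realType) (T : topologicalType).
Hypothesis pT : polish R T.

Lemma polish_hausdorff : hausdorff_space T.
Proof.
have [_ [d [d0 dC dD dn _]]] := pT.
move=> x y xy; apply/d0/eqP/negPn/negP => dxy.
have dge0 z t : 0 <= d z t.
  have := dD z t z; rewrite (dC t z) (iffRL (d0 z z) erefl).
  by rewrite -mulr2n pmulrn_lge0.
have dxy0 : 0 < d x y / 2 by rewrite divr_gt0// lt_def dxy dge0.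
have [||z [/= xz yz]] := xy [set z | d x z < d x y / 2] [set z | d y z < d x y / 2].
- by apply/dn; exists (d x y / 2) => // z.
- by apply/dn; exists (d x y / 2) => // z.
- have := dD x z y; rewrite (dC z y); lra.
Qed.

Lemma polish_second_countable : @second_countable T.
Proof.
have [[D cD dD] [d [d0 dC dT dn _]]] := pT.
pose ball x (n : nat) := [set y | d x y < n.+1%:R^-1].
exists [set (ball p.1 p.2)^° | p in D `*` setT].
  by apply: (card_le_trans (card_image_le _ _)); exact: countableX.
split=> [_ [[x n] _ <-]|x W /dn[e e0 eW]]; first exact: open_interior.
have [n ne] : exists n : nat, n.+1%:R^-1 < e / 2.
  exists (Num.truncn (e / 2)^-1).
  rewrite invf_plt ?posrE//; last lra.
  by rewrite -Num.Theory.truncn_lt_nat// invr_ge0; lra.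
have nx : nbhs x (ball x n) by apply/dn; exists n.+1%:R^-1; [rewrite invr_gt0 ltr0n|].
(* Index [n.*2.+1] has half the radius of index [n]: [z] is so close to [x] that [ball z n] is a
   neighbourhood of [x] and still lies within [e] of it. *)
have [z [Dz xz]] : exists z, D z /\ (ball x n.*2.+1)^° z.
  have [||z [zx Dz]] := dD (ball x n.*2.+1)^°; last by exists z.
    exists x; apply: nbhs_singleton; apply: nbhs_interior.
    by apply/dn; exists n.*2.+2%:R^-1; [rewrite invr_gt0 ltr0n|].
  exact: open_interior.
have dxz := interior_subset xz.
have h2 : n.*2.+2%:R^-1 = n.+1%:R^-1 / 2 :> R.
  by rewrite -doubleS -mul2n natrM invfM mulrC.
exists (ball z n)^°; first split; first by exists (z, n).
- apply/dn; exists (n.+1%:R^-1 - d x z).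
    have n0 : (0 : R) < n.+1%:R^-1 by rewrite invr_gt0.
    by rewrite subr_gt0 (lt_trans dxz)// h2 ltr_pdivrMr// ltr_pMr// ltr1n.
  move=> y /= xy; rewrite /ball /= (le_lt_trans (dT z x y))// (dC z x).
  by rewrite addrC -ltrBrDr.
- move=> y /interior_subset; rewrite /ball /= => zy; apply: eW => /=.
  rewrite (le_lt_trans (dT x z y))// (lt_le_trans (ltrD dxz zy))// h2.
  by move: ne; set u := _^-1; lra.
Qed.

End polish.

Section borel_sets.
Context (T : topologicalType) (x0 : T).

Lemma open_borel (A : set T) : open A -> measurable (A : set (borel x0)).
Proof. by move=> oA; exact: sub_sigma_algebra. Qed.

Lemma closed_borel (A : set T) : closed A -> measurable (A : set (borel x0)).
Proof.
move=> cA; rewrite -(setCK A); apply: (@measurableC _ (borel x0)).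
by apply: open_borel; exact: closed_openC.
Qed.

Lemma open_measurable_fun (d : measure_display) (T' : measurableType d)
    (f : T' -> borel x0) :
  (forall U : set T, open U -> measurable (f @^-1` U)) -> measurable_fun setT f.
Proof.
move=> fo; have mE : @measurable _ (borel x0) = <<s @open (pointed_at x0) >> by [].
apply: (measurability _ mE).
by move=> _ [U oU <-]; rewrite setTI; exact: fo.
Qed.

End borel_sets.

Lemma continuous_borel (T1 T2 : topologicalType) (x1 : T1) (x2 : T2)
    (f : T1 -> T2) : continuous f ->
  measurable_fun setT (f : borel x1 -> borel x2).
Proof.
by move=> /continuousP cf; apply: open_measurable_fun => U /cf ?; exact: open_borel.
Qed.

Section continuous_prod.
Context (T1 T2 T3 : topologicalType) (x1 : T1) (x2 : T2) (x3 : T3).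
Hypotheses (scT1 : @second_countable T1) (scT2 : @second_countable T2).

(** The product of two Borel sigma-algebras can be smaller than the Borel sigma-algebra of the
    product. Second countability makes each open set a countable union of open rectangles. *)
Lemma continuous_borel_prod (f : T1 * T2 -> T3) : continuous f ->
  measurable_fun setT (f : borel x1 * borel x2 -> borel x3).
Proof.
move=> /continuousP cf; apply: open_measurable_fun => U /cf oU.
apply: (second_countable_locally (second_countable_prod scT1 scT2)
  (S := @measurable _ (borel x1 * borel x2)%type)) => //.
  by move=> F mF; exact: bigcupT_measurable.
move=> [y1 y2] fy.
have : nbhs (y1, y2) (f @^-1` U) by exact: open_nbhs_nbhs.
move=> [[/= V W] [V1 W2] VW]; exists (V^° `*` W^°); split.
- by apply: measurableX; apply: open_borel; exact: open_interior.
- by exists (V^°, W^°) => //; split; exact: nbhs_interior.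
- by apply: subset_trans VW => -[z1 z2] [/= /interior_subset ? /interior_subset].
Qed.

End continuous_prod.

(** * Path spaces and the translation action *)

Lemma cvg_initialP (S : choiceType) (T : topologicalType) (f : S -> T)
    (F : set_system S) (s : S) : Filter F ->
  f @ F --> f s -> F --> (s : initial_topology f).
Proof.
move=> FF cF A [_ [[B oB <-] Bfs BA]]; apply: filterS BA _.
by apply: cF; exact: open_nbhs_nbhs.
Qed.

Lemma continuous_at_comp2 (X T U V : topologicalType) (f : X -> T) (g : X -> U)
    (h : T -> U -> V) (x : X) :
  continuous (fun p : T * U => h p.1 p.2) ->
  {for x, continuous f} -> {for x, continuous g} ->
  {for x, continuous (fun z => h (f z) (g z))}.
Proof.
move=> ch cf cg; apply: (@continuous_comp _ _ _ (fun z => (f z, g z))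
  (fun p : T * U => h p.1 p.2)); last exact: ch.
exact: (@cvg_pair _ _ _ (nbhs x) (nbhs (f x)) (nbhs (g x)) _ _ _ f g cf cg).
Qed.

(** Tube lemma with a filter in place of the second factor. It turns joint continuity into uniform
    convergence on compacts, both for paths and for families of measures. *)
Lemma compact_uniform_near (X : topologicalType) (V : uniformType) (I : Type)
    (F : set_system I) (K : set X) (f : I -> X -> V) (h : X -> V)
    (E : set (V * V)) : Filter F -> compact K -> entourage E ->
  (forall x, K x -> h x' @[x' --> x] --> h x) ->
  (forall x, K x -> f p.2 p.1 @[p --> (nbhs x, F)] --> h x) ->
  \forall i \near F, forall x, K x -> E (h x, f i x).
Proof.
move=> FF /compact_near_coveringP cK eE ch cf.
apply: (cK I F (fun i x => E (h x, f i x)) FF) => x Kx.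
have eE' := entourage_split_ent eE.
have hx := cvg_entourage (ch _ Kx) (entourage_inv eE').
have := cvg_entourage (cf _ Kx) eE'.
move=> [[/= U V'] [U1 V2] UV]; exists (U `&` [set x' | split_ent E (h x', h x)], V').
  by split => /=; [apply: (filterI U1); exact: hx|exact: V2].
move=> [x' i] [/= [Ux' Ex'] V'i] /=; apply: (entourage_split (h x)) => //.
exact: (UV (x', i)).
Qed.

Section path_space.
Context (R : realType) (Y : topologicalGroupType) (Gam : set (paths R Y)).
Hypothesis pG : path_space Gam.

Lemma path_continuous (g : Gam) : continuous (val g : R -> Y).
Proof. by case: pG => cG _ _ _ _; apply: cG; exact: set_valP. Qed.

Lemma cvg_path (F : set_system Gam) (g : Gam) : Filter F ->
  (forall L E, compact L -> entourage E ->
    \forall g' \near F, forall s, L s -> E (val g s, val g' s)) -> F --> g.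
Proof.
move=> FF cF; apply: (@cvg_initialP _ _ (set_val : Gam -> paths R Y)).
apply/fam_cvgP => L cL A /uniform_nbhs[E [eE EA]].
by apply: filterS (cF L E cL eE) => g' h; exact: EA.
Qed.

Lemma path_nbhs (g : Gam) (L : set R) (E : set (Y * Y)) :
  compact L -> entourage E ->
  nbhs g [set g' : Gam | forall s, L s -> E (val g s, val g' s)].
Proof.
move=> cL eE.
exact: (@initial_continuous _ _ (set_val : Gam -> paths R Y) g _
  (@fam_nbhs _ _ _ L E (val g : paths R Y) eE cL)).
Qed.

Lemma path_eval_continuous : continuous (fun p : R * Gam => val p.2 p.1 : Y).
Proof.
move=> [s g] /=; apply/cvg_app_entourageP => E eE.
have eE' := entourage_split_ent eE.
have cs := cvg_entourage (@path_continuous g s) eE'.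
exists ([set s' | split_ent E (val g s, val g s')] `&` [set` `[s - 1, s + 1]],
  [set g' : Gam | forall s', [set` `[s - 1, s + 1]] s' ->
    split_ent E (val g s', val g' s')]).
  split=> /=; last by apply: path_nbhs => //; exact: segment_compact.
  apply: filterI; first exact: cs.
  apply: filterS (nbhsx_ballx s 1 ltr01) => s'.
  by rewrite /ball set_itvE /= ltr_distlC => /andP[? ?]; apply/andP; split; lra.
move=> [s' g'] [/= [E1 s1] E2] /=; apply: (entourage_split (val g s') eE E1).
exact: E2.
Qed.

Lemma evalt_continuous (s : R) : continuous (fun g : Gam => val g s : Y).
Proof.
move=> g; apply: (@continuous_at_comp2 _ _ _ _ (fun=> s) id
  (fun s (g : Gam) => val g s : Y) g path_eval_continuous) => //.
exact: cst_continuous.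
Qed.

Section action.
Hypothesis stable : forall y : Y, left_translate y @` Gam = Gam.

Definition act (y : Y) (g : Gam) : Gam := induced_map (stable y) g.

Lemma actE y g s : val (act y g) s = (y * val g s)%g.
Proof. by []. Qed.

Lemma path_inj (g g' : Gam) : (forall s, val g s = val g' s) -> g = g'.
Proof. by move=> e; apply: val_inj; apply/funext. Qed.

Lemma actM y z g : act (y * z)%g g = act y (act z g).
Proof. by apply: path_inj => s; rewrite !actE mulgA. Qed.

Lemma act1 g : act 1%g g = g.
Proof. by apply: path_inj => s; rewrite !actE mul1g. Qed.

Lemma act_continuous : continuous (fun p : Y * Gam => act p.1 p.2).
Proof.
move=> [y g] /=; apply: cvg_path => L E cL eE.
pose h s : Y := (y * val g s)%g.
pose f (p : Y * Gam) s : Y := (p.1 * val p.2 s)%g.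
apply: (@compact_uniform_near _ _ _ (nbhs (y, g)) L f h) => // s _.
  apply: (@continuous_at_comp2 _ _ _ _ (fun=> y) (val g) (@monoid.mul Y) s
    (@mulg_continuous Y)).
    exact: cst_continuous.
  exact: path_continuous.
have c2 : continuous (fun q : R * (Y * Gam) => q.2).
  by move=> q; exact: cvg_snd.
have c21 : continuous (fun q : R * (Y * Gam) => q.2.1).
  by move=> q; exact: (continuous_comp (c2 q) (@cvg_fst _ _ _ _ _)).
have c22 : continuous (fun q : R * (Y * Gam) => q.2.2).
  by move=> q; exact: (continuous_comp (c2 q) (@cvg_snd _ _ _ _ _)).
apply: (@continuous_at_comp2 _ _ _ _ (fun q => q.2.1)
  (fun q : R * (Y * Gam) => val q.2.2 q.1) (@monoid.mul Y) (s, (y, g))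
  (@mulg_continuous Y)).
  exact: c21.
apply: (@continuous_at_comp2 _ _ _ _ fst (fun q => q.2.2)
  (fun s (g : Gam) => val g s : Y) (s, (y, g)) path_eval_continuous).
  exact: cvg_fst.
exact: c22.
Qed.

Lemma act_continuousr (y : Y) : continuous (act y).
Proof.
move=> g; exact: (@continuous_at_comp2 _ _ _ _ (fun=> y) id act g
  act_continuous (@cst_continuous _ _ _ _)).
Qed.

End action.
End path_space.

(** * Cylinders and the Borel sets of the path space *)

Section cylinders.
Context (R : realType) (Y : topologicalGroupType) (Gam : set (paths R Y)).
Hypothesis pG : path_space Gam.

(** The sets given by a radius and an entourage are the base of a filter. This filter converges to
    [g] because compact sets of times are bounded, so each neighbourhood contains one of them. *)
Lemma path_nbhs_ex (g : Gam) (O : set Gam) : nbhs g O ->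
  exists n E, entourage E /\
    forall g' : Gam, (forall s, `|s| <= n%:R -> E (val g s, val g' s)) -> O g'.
Proof.
pose ball (nE : nat * set (Y * Y)) :=
  [set g' : Gam | forall s, `|s| <= nE.1%:R -> nE.2 (val g s, val g' s)].
pose F := filter_from [set nE : nat * set (Y * Y) | entourage nE.2] ball.
have FF : Filter F.
  apply: filter_from_filter.
    by exists (0%N, setT); exact: entourageT.
  move=> [n1 E1] [n2 E2] /= eE1 eE2; exists (maxn n1 n2, E1 `&` E2).
    exact: filterI.
  move=> g' /= h; split=> s sn.
    by have [] := h s (le_trans sn _); rewrite // ler_nat leq_maxl.
  by have [] := h s (le_trans sn _); rewrite // ler_nat leq_maxr.
have Fg : F --> g.
  apply: (cvg_path FF) => L E cL eE.
  have [M [_ LM]] := compact_bounded cL.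
  exists ((Num.truncn (M + 1)).+1, E) => //= g' h s Ls; apply: h => /=.
  apply: (le_trans (LM (M + 1) _ s Ls)); first by rewrite ltrDl.
  exact/ltW/truncnS_gt.
move=> /Fg [[n E] /= eE EO]; exists n, E; split=> // g' h; exact: EO.
Qed.

Definition eval_open : set (set Gam) :=
  [set A | exists s U, open U /\ A = (fun g : Gam => val g s : Y) @^-1` U].

(** A basic neighbourhood constrains a path at uncountably many times. Paths being continuous,
    constraints at rational times are enough, and these form a countable intersection of
    cylinders. *)
Lemma borel_path_cylinder (gam0 : Gam) :
  @measurable _ (borel gam0) = <<s eval_open >>.
Proof.
apply/seteqP; split; last first.
  apply: smallest_sub; first exact: sigma_algebra_measurable.
  move=> _ [s [U [oU ->]]]; apply: open_borel.
  by apply: open_comp => // g _; exact: (evalt_continuous pG).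
apply: smallest_sub; first exact: smallest_sigma_algebra.
have scG : @second_countable Gam.
  by case: pG => _ _ /polish_second_countable.
pose B : measurableType _ :=
  g_sigma_algebraType (eval_open : set (set (pointed_at gam0))).
move=> O oO; apply: (second_countable_locally scG (S := <<s eval_open >>)).
- exact: (@measurable0 _ B).
- by move=> F mF; exact: (@bigcupT_measurable _ B).
move=> g Og.
have [n [E [eE EO]]] := path_nbhs_ex (open_nbhs_nbhs (conj oO Og)).
(* The comparison at [s] will pass through a rational time [q]: from [g s] to [g q] and to [g' q] by
   [E1], then to [g' s] by [split_ent E]. *)
pose E1 := split_ent (split_ent E).
have eE1 : entourage E1 by do 2 apply: entourage_split_ent.
pose U s := (xsection E1 (val g s))^°.
(* The bound is [n.+1] because a rational close to some [s] of [[-n, n]] may lie outside this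
   interval. *)
pose W := \bigcap_(q in [set: rat])
  [set g' : Gam | `|ratr q| <= n.+1%:R :> R -> U (ratr q) (val g' (ratr q))].
exists W; split.
- rewrite -[W]setCK; apply: (@measurableC _ B); rewrite setC_bigcap.
  apply: (@bigcupT_measurable_rat _ B) => q.
  apply: (@measurableC _ B).
  have [qn|qn] := boolP (`|ratr q| <= n.+1%:R :> R); last first.
    set V := (X in measurable X); suff -> : V = setT by exact: measurableT.
    by apply/seteqP; split => // g' _ /=; rewrite (negbTE qn).
  apply: sub_sigma_algebra; exists (ratr q), (U (ratr q)).
  split; first exact: open_interior.
  by apply/seteqP; split => g' /=; [apply|move=> ? _].
- have cL : compact `[- n.+1%:R, n.+1%:R : R]%classic by exact: segment_compact.
  apply: filterS (path_nbhs g cL (entourage_split_ent eE1)) => g' h q _ qn.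
  apply: filterS (nbhs_entourage (val g' (ratr q)) (entourage_split_ent eE1)).
  move=> z /xsectionP gz; apply/xsectionP; apply: (entourage_split _ eE1 _ gz).
  by apply: h; rewrite set_itvE /= -ler_norml.
- move=> g' Wg'; apply: EO => s sn.
  have gs := cvg_entourage (@path_continuous _ _ _ pG g s) eE1.
  have g's := cvg_entourage (@path_continuous _ _ _ pG g' s)
    (entourage_inv (entourage_split_ent eE)).
  have N : \forall s' \near s, [/\ E1 (val g s, val g s'),
      split_ent E (val g' s', val g' s) & `|s'| <= n.+1%:R].
    have s1 : \forall s' \near s, `|s'| <= n.+1%:R.
      apply: filterS (nbhsx_ballx s 1 ltr01) => s' ss'.
      rewrite -[s'](subrK s) -natr1 [_ + 1]addrC.
      by rewrite (le_trans (ler_normD _ _))// lerD// distrC ltW.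
    by near=> s'; split; near: s'; [exact: gs|exact: g's|exact: s1].
  have [r [/interior_subset[gq g'q qn] [q _ qE]]] :
      [set s' | [/\ E1 (val g s, val g s'), split_ent E (val g' s', val g' s) &
        `|s'| <= n.+1%:R]]^° `&` (@ratr R @` setT) !=set0.
    apply: dense_rat; last exact: open_interior.
    by exists s; exact: nbhs_singleton (nbhs_interior N).
  rewrite -{r}qE in gq g'q qn.
  apply: (entourage_split _ eE _ g'q).
  apply: (entourage_split _ (entourage_split_ent eE) gq).
  by have /interior_subset/xsectionP := Wg' q I qn.
Unshelve. all: end_near. Qed.

End cylinders.

(* A right translation is a left translation in the opposite group, and nothing
   else in the statement depends on the group law: the right case of the theorem
   is convertible to the left case for [opposite Y]. *)
Definition opposite (G : Type) : Type := G.

Section opposite_group.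
Variable Y : topologicalGroupType.

Definition opposite_mul (x y : opposite Y) : opposite Y := (y * x :> Y)%g.

HB.instance Definition _ := Uniform.on (opposite Y).

Lemma opposite_mulA : associative opposite_mul.
Proof. by move=> x y z; rewrite /opposite_mul mulgA. Qed.

Lemma opposite_mul1 : left_id (1%g : Y) opposite_mul.
Proof. by move=> x; rewrite /opposite_mul mulg1. Qed.

Lemma opposite_1mul : right_id (1%g : Y) opposite_mul.
Proof. by move=> x; rewrite /opposite_mul mul1g. Qed.

Lemma opposite_mulV : left_inverse (1%g : Y) (fun x : Y => x^-1)%g opposite_mul.
Proof. by move=> x; rewrite /opposite_mul mulgV. Qed.

Lemma opposite_Vmul : right_inverse (1%g : Y) (fun x : Y => x^-1)%g opposite_mul.
Proof. by move=> x; rewrite /opposite_mul mulVg. Qed.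

HB.instance Definition _ := isGroup.Build (opposite Y)
  opposite_mulA opposite_mul1 opposite_1mul opposite_mulV opposite_Vmul.

Lemma opposite_mul_continuous :
  continuous (fun xy : opposite Y * opposite Y => (xy.1 * xy.2)%g).
Proof.
move=> xy.
pose f (z : Y * Y) : Y := (z.1 * z.2)%g; pose g (z : Y * Y) := (z.2, z.1).
apply: (@continuous_comp _ _ _ g f); last exact: mulg_continuous.
by apply: cvg_pair; [exact: cvg_snd|exact: cvg_fst].
Qed.

Lemma opposite_inv_continuous : continuous (fun x : opposite Y => (x^-1)%g).
Proof. exact: (@invg_continuous Y). Qed.

HB.instance Definition _ := isTopologicalGroup.Build (opposite Y)
  opposite_mul_continuous opposite_inv_continuous.

End opposite_group.

(** * Haar measures *)

Definition image_measure d1 d2 (T1 : measurableType d1) (T2 : measurableType d2)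
    (R : realType) (m : {measure set T1 -> \bar R}) (f : T1 -> T2)
    (mf : measurable_fun setT f) : {measure set T2 -> \bar R} :=
  measure_function_pushforward__canonical__measure_function_Measure m mf.

Definition image_probability d1 d2 (T1 : measurableType d1)
    (T2 : measurableType d2) (R : realType) (P : probability T1 R)
    (f : T1 -> T2) (mf : measurable_fun setT f) : probability T2 R :=
  distribution P (HB.pack_for {mfun T1 >-> T2} f
    (isMeasurableFun.Build _ _ _ _ f mf)).

Definition sigma_finite_pack d (T : measurableType d) (R : realType)
    (m : {measure set T -> \bar R}) (sf : sigma_finite setT m) :
    {sigma_finite_measure set T -> \bar R} :=
  HB.pack_for {sigma_finite_measure set T -> \bar R} (Measure.sort m)
    (isSFinite.Build _ _ _ _ (sfinite_measure_sigma_finite sf))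
    (isSigmaFinite.Build _ _ _ _ sf).

Section sigma_finite_measures.
Local Open Scope ereal_scope.
Context d1 d2 (T1 : measurableType d1) (T2 : measurableType d2) (R : realType).
Variables (m1 : {measure set T1 -> \bar R}) (m2 : {measure set T2 -> \bar R}).
Hypotheses (sf1 : sigma_finite setT m1) (sf2 : sigma_finite setT m2).

Lemma sigma_finite_fubini (f : T1 * T2 -> \bar R) : measurable_fun setT f ->
  (forall p, 0 <= f p) ->
  \int[m1]_x \int[m2]_y f (x, y) = \int[m2]_y \int[m1]_x f (x, y).
Proof.
move=> mf f0.
exact: (@fubini_tonelli _ _ _ _ _ (sigma_finite_pack sf1) (sigma_finite_pack sf2)).
Qed.

Lemma sigma_finite_measurable_xsection (A : set (T1 * T2)) : measurable A ->
  measurable_fun setT (fun x => m2 (xsection A x)).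
Proof.
move=> mA.
exact: (@measurable_fun_xsection _ _ _ _ _ (sigma_finite_pack sf2)).
Qed.

Lemma sigma_finite_product_unique (m : {measure set (T1 * T2) -> \bar R}) :
  (forall A B, measurable A -> measurable B -> m (A `*` B) = m1 A * m2 B) ->
  forall X, measurable X -> m X = \int[m1]_x m2 (xsection X x).
Proof.
move=> mE X mX.
apply/esym; exact: (@product_measure_unique _ _ _ _ _
  (sigma_finite_pack sf1) (sigma_finite_pack sf2)).
Qed.

End sigma_finite_measures.

Section haar.
Local Open Scope ereal_scope.
Context (R : realType) (Y : topologicalGroupType).
Hypotheses (scY : @second_countable Y).

Definition left_invariant (m : set (borel (1%g : Y)) -> \bar R) :=
  forall (y : Y) (B : set (borel (1%g : Y))), measurable B ->
    m [set x : Y | B (y * x)%g] = m B.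

Lemma mulgl_continuous (y : Y) : continuous (fun x : Y => y * x)%g.
Proof.
move=> x; exact: (@continuous_at_comp2 _ _ _ _ (fun=> y) id (@monoid.mul Y) x
  (@mulg_continuous Y) (@cst_continuous _ _ _ _)).
Qed.

Lemma mulgr_continuous (y : Y) : continuous (fun x : Y => x * y)%g.
Proof.
move=> x; exact: (@continuous_at_comp2 _ _ _ _ id (fun=> y) (@monoid.mul Y) x
  (@mulg_continuous Y) _ (@cst_continuous _ _ _ _)).
Qed.

Lemma measurable_mulgl (y : Y) : measurable_fun setT
  ((fun x : Y => y * x)%g : borel (1%g : Y) -> borel (1%g : Y)).
Proof. exact: (@continuous_borel Y Y 1%g 1%g _ (@mulgl_continuous y)). Qed.

Lemma measurable_mulgr (y : Y) : measurable_fun setT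
  ((fun x : Y => x * y)%g : borel (1%g : Y) -> borel (1%g : Y)).
Proof. exact: (@continuous_borel Y Y 1%g 1%g _ (@mulgr_continuous y)). Qed.

Lemma left_invariant_integral (m : {measure set (borel (1%g : Y)) -> \bar R})
    (f : borel (1%g : Y) -> \bar R) (y : Y) :
  left_invariant m -> measurable_fun setT f -> (forall x, 0 <= f x) ->
  \int[m]_x f (y * x)%g = \int[m]_x f x.
Proof.
move=> im mf f0.
transitivity (\int[image_measure m (measurable_mulgl y)]_x f x).
  have := @ge0_integral_pushforward _ _ _ _ R _ (measurable_mulgl y) m setT f
    measurableT mf (fun x _ => f0 x).
  by rewrite preimage_setT => <-.
by apply: eq_measure_integral => B mB _; exact: im.
Qed.

Section uniqueness.
Variables (mu lam : {measure set (borel (1%g : Y)) -> \bar R}).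
Hypotheses (sfmu : sigma_finite setT mu) (sflam : sigma_finite setT lam).
Hypotheses (imu : left_invariant mu) (ilam : left_invariant lam).
Variable E : set (borel (1%g : Y)).
Hypothesis mE : measurable E.

Let w (x : Y) := mu [set y : Y | E (y * x)%g].

(* Both integrals equal that of [f(x) 1_E(yx)] over [lam x mu], rewritten by
   [x := y^-1 x] and then [y := x y]: each substitution is a left translation.
   The second factor on the right does not involve [lam], whence uniqueness. *)
Lemma haar_fubini (f : borel (1%g : Y) -> \bar R) :
  measurable_fun setT f -> (forall x, 0 <= f x) ->
  \int[lam]_x (f x * w x) = lam E * \int[mu]_y f (y^-1)%g.
Proof.
move=> mf f0.
have mmul : measurable_fun setT ((fun p : Y * Y => p.2 * p.1)%g :
    borel (1%g : Y) * borel (1%g : Y) -> borel (1%g : Y)).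
  exact: (@continuous_borel_prod Y Y Y 1%g 1%g 1%g scY scY _
    (@mulg_continuous (opposite Y))).
have mE1 : measurable_fun setT (fun x : borel (1%g : Y) => (\1_E x)%:E : \bar R).
  by apply/measurable_EFinP; exact: measurable_indic.
have minv : measurable_fun setT
    ((fun x : Y => x^-1)%g : borel (1%g : Y) -> borel (1%g : Y)).
  exact: (@continuous_borel Y Y 1%g 1%g _ (@invg_continuous Y)).
have mdiv : measurable_fun setT ((fun p : Y * Y => p.2^-1 * p.1)%g :
    borel (1%g : Y) * borel (1%g : Y) -> borel (1%g : Y)).
  exact: (measurableT_comp mmul (measurable_fun_pair measurable_fst
    (measurableT_comp minv measurable_snd))).
have i0 (x : Y) : 0 <= (\1_E x)%:E :> \bar R by rewrite lee_fin.
have mc (x : borel (1%g : Y)) : measurable_fun setT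
    (fun y : borel (1%g : Y) => (\1_E (y * x)%g)%:E : \bar R).
  exact: (measurableT_comp mE1 (measurable_mulgr x)).
transitivity (\int[lam]_x \int[mu]_y (f x * (\1_E (y * x)%g)%:E)).
  apply: eq_integral => x _.
  rewrite ge0_integralZl// ?f0//; congr (_ * _).
  have mEx : measurable [set y : borel (1%g : Y) | E (y * x)%g].
    by have := measurable_mulgr x measurableT mE; rewrite setTI.
  by rewrite /w -[X in mu X]setIT -integral_indic.
rewrite (sigma_finite_fubini sflam sfmu
  (f := fun p => f p.1 * (\1_E (p.2 * p.1)%g)%:E)); last 2 first.
  - apply: emeasurable_funM; first exact: (measurableT_comp mf measurable_fst).
    exact: (measurableT_comp mE1 mmul).
  - by move=> p; exact: mule_ge0.
transitivity (\int[mu]_y \int[lam]_x (f (y^-1 * x)%g * (\1_E x)%:E)).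
  apply: eq_integral => y _.
  rewrite -(@left_invariant_integral _ (fun x => f x * (\1_E (y * x)%g)%:E) y^-1%g)//.
  - by apply: eq_integral => x _; rewrite mulVKg.
  - apply: emeasurable_funM => //.
    exact: (measurableT_comp mE1 (measurable_mulgl y)).
  - by move=> x; exact: mule_ge0.
rewrite -(sigma_finite_fubini sflam sfmu
  (f := fun p => f (p.2^-1 * p.1)%g * (\1_E p.1)%:E)); last 2 first.
  - apply: emeasurable_funM; first exact: (measurableT_comp mf mdiv).
    exact: (measurableT_comp mE1 measurable_fst).
  - by move=> p; exact: mule_ge0.
have mfV : measurable_fun setT (fun y : borel (1%g : Y) => f (y^-1)%g).
  exact: (measurableT_comp mf minv).
transitivity (\int[lam]_x ((\int[mu]_y f (y^-1)%g) * (\1_E x)%:E)).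
  apply: eq_integral => x _ /=.
  have mfx : measurable_fun setT (fun y : borel (1%g : Y) => f (y^-1 * x)%g).
    exact: (measurableT_comp (measurableT_comp mf (measurable_mulgr x)) minv).
  rewrite ge0_integralZr//; congr (_ * _).
  rewrite -(@left_invariant_integral _ (fun y => f (y^-1 * x)%g) x)//.
  by apply: eq_integral => y _; rewrite invgM mulgVK.
rewrite ge0_integralZl//; last by exact: integral_ge0.
by rewrite integral_indic// setIT muleC.
Qed.

End uniqueness.

(** With [f = 1_B / w], [haar_fubini] reads [lam B = lam E * c] where [c] depends on [mu] and [B]
    only; taking [lam := mu] gives [mu B = mu E * c]. The weight [w] is not constant in general, the
    group being possibly non-unimodular, hence the hypothesis on all right translates of [E]. *)
Lemma haar_unique (mu lam : {measure set (borel (1%g : Y)) -> \bar R})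
    (E B : set (borel (1%g : Y))) :
  sigma_finite setT mu -> sigma_finite setT lam ->
  left_invariant mu -> left_invariant lam -> measurable E ->
  (forall x, 0 < mu [set y : Y | E (y * x)%g] < +oo) ->
  measurable B -> lam B * mu E = lam E * mu B.
Proof.
move=> sfmu sflam imu ilam mE w0 mB.
pose w (x : borel (1%g : Y)) := mu [set y : Y | E (y * x)%g].
have mmul : measurable_fun setT ((fun p : Y * Y => p.2 * p.1)%g :
    borel (1%g : Y) * borel (1%g : Y) -> borel (1%g : Y)).
  exact: (@continuous_borel_prod Y Y Y 1%g 1%g 1%g scY scY _
    (@mulg_continuous (opposite Y))).
have mw : measurable_fun setT w.
  have mEm := mmul measurableT _ mE; rewrite setTI in mEm.
  have := sigma_finite_measurable_xsection sfmu mEm.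
  congr measurable_fun; apply/funext => x; congr (mu _).
  by apply/seteqP; split => y; rewrite /xsection /= inE.
(* The reciprocal is written as a power so that [measurable_powR] applies. *)
pose f (x : borel (1%g : Y)) : \bar R := (\1_B x * (fine (w x)) `^ (-1))%:E.
have mf : measurable_fun setT f.
  apply/measurable_EFinP/measurable_funM; first exact: measurable_indic.
  apply: (measurableT_comp (measurable_powR _)).
  exact: (measurableT_comp (fine_measurable measurableT) mw).
have f0 x : 0 <= f x by rewrite lee_fin mulr_ge0 ?powR_ge0.
have fw x : f x * w x = (\1_B x)%:E.
  have [w0' woo] := andP (w0 x).
  have wf : w x \is a fin_num by rewrite ge0_fin_numE ?ltW.
  rewrite /f powR_inv1 ?fine_ge0 ?ltW// -{2}(fineK wf) -EFinM mulfVK//.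
  by rewrite gt_eqF// fine_gt0// w0' woo.
have q (m : {measure set (borel (1%g : Y)) -> \bar R}) :
    sigma_finite setT m -> left_invariant m -> m B = m E * \int[mu]_y f (y^-1)%g.
  move=> sfm im; rewrite -(@haar_fubini mu m)// -[in LHS](setIT B).
  by rewrite -integral_indic//; apply: eq_integral => x _; rewrite fw.
by rewrite (q lam)// [X in _ = _ * X](q mu)// muleAC muleA.
Qed.

End haar.

Section left_haar.
Local Open Scope ereal_scope.
Context (R : realType) (Y : topologicalGroupType).
Variable mu : {measure set (borel (1%g : Y)) -> \bar R}.
Hypotheses (lcY : locally_compact [set: Y]) (pY : polish R Y).
Hypothesis mu_haar : left_haar mu.

Let scY := polish_second_countable pY.

Lemma left_haar_invariant : left_invariant mu.
Proof.
case: mu_haar => _ _ im y B mB; rewrite -(im y^-1%g _ mB); congr (mu _).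
apply/seteqP; split=> x /= => [Byx|[z Bz <-]]; last by rewrite mulVKg.
by exists (y * x)%g => //; rewrite mulKg.
Qed.

Lemma compact_nbhs (x : Y) : exists2 K : set Y, nbhs x K & compact K.
Proof.
have [K xK [cK _]] := lcY (Logic.I : [set: Y] x).
exists K => //.
have {}xK : nbhs x (fun y => [set: Y] y -> K y) := xK.
by apply: filterS xK => y; exact.
Qed.

Lemma measure_compact_lty (A K : set Y) : compact K ->
  measurable (A : set (borel (1%g : Y))) -> A `<=` K -> mu A < +oo.
Proof.
move=> cK mA AK; case: mu_haar => -[muK _] _ _.
apply: le_lt_trans (muK K cK); apply: le_measure => //; rewrite inE //.
by apply: closed_borel; exact: (compact_closed (polish_hausdorff pY)).
Qed.

Lemma haar_open_cover : exists2 U : (set Y)^nat,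
  (forall n, open (U n) /\ mu (U n) < +oo) & \bigcup_n U n = setT.
Proof.
have [||U SU ->] := second_countable_bigcup scY
  (S := [set U | open U /\ mu U < +oo]) (O := setT); last by exists U.
  by rewrite /= measure0; split; [exact: open0|exact: ltry].
move=> x _; have [K xK cK] := compact_nbhs x.
exists K^°; split => //; last exact: nbhs_interior.
split; first exact: open_interior.
apply: (measure_compact_lty cK); last exact: interior_subset.
exact: (@open_borel _ _ _ (@open_interior _ K)).
Qed.

Lemma haar_sigma_finite : sigma_finite setT mu.
Proof.
have [U Uo UT] := haar_open_cover; exists U => // n.
by have [oU ?] := Uo n; split => //; exact: open_borel.
Qed.

(** The left translates of a null nonempty open set would cover [Y]; countably many of them suffice,
    so [mu] would vanish. *)
Lemma haar_open_gt0 (U : set Y) : open U -> U !=set0 -> 0 < mu U.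
Proof.
move=> oU [u Uu]; rewrite lt_def measure_ge0 andbT.
apply/negP => /eqP U0; case: mu_haar => _ /eqP + _; apply.
suff [] : measurable (setT : set (borel (1%g : Y))) /\ mu setT = 0 by [].
apply: (second_countable_locally scY
    (S := fun A => measurable (A : set (borel (1%g : Y))) /\ mu A = 0)).
- by split=> //; exact: measure0.
- move=> F SF; split; first by apply: bigcupT_measurable => n; case: (SF n).
  apply/eqP; rewrite -measure_le0.
  rewrite (le_trans (generalized_Boole_inequality _ _ _))//.
  + by move=> n; case: (SF n).
  + by apply: bigcupT_measurable => n; case: (SF n).
  + by rewrite eseries0// => n _ _; case: (SF n).
- move=> x _; exists [set z | U (u * x^-1 * z)%g].
  have oV : open [set z | U (u * x^-1 * z)%g].
    by apply: open_comp => // z _; exact: mulgl_continuous.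
  split=> //; last by apply: open_nbhs_nbhs; split => //=; rewrite mulgVK.
  split; first exact: open_borel.
  by rewrite left_haar_invariant//; exact: open_borel.
Qed.

Lemma msupp_haar : msupp mu = setT.
Proof.
apply/seteqP; split=> // x _ U oU Ux.
by apply: haar_open_gt0 => //; exists x.
Qed.

(** Supplies the set required by [haar_unique]. Left invariance says nothing of the right
    translates: they have positive measure because they are open, and finite measure because they
    lie in the compact sets [K x^-1]. *)
Lemma haar_test_set : exists2 E : set Y, open E &
  forall x, 0 < mu [set y | E (y * x)%g] < +oo.
Proof.
have [K K1 cK] := compact_nbhs 1%g.
exists K^°; first exact: open_interior.
move=> x.
have oE : open [set y | K^° (y * x)%g].
  by apply: open_comp; [move=> y _; exact: mulgr_continuous|exact: open_interior].
apply/andP; split.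
  apply: haar_open_gt0 => //; exists x^-1%g; rewrite /= mulVg.
  exact: nbhs_singleton (nbhs_interior K1).
apply: (@measure_compact_lty _ ((fun z : Y => z * x^-1)%g @` K)).
- apply: continuous_compact => //.
  by apply: continuous_subspaceT; exact: mulgr_continuous.
- exact: open_borel.
- by move=> y /interior_subset Ky; exists (y * x)%g => //; rewrite mulgK.
Qed.

End left_haar.

(** * Translation-invariant measures on paths *)

Section invariant_path_measures.
Local Open Scope ereal_scope.
Context (R : realType) (Y : topologicalGroupType).
Variable mu : {measure set (borel (1%g : Y)) -> \bar R}.
Context (Gam : set (paths R Y)) (gam0 : Gam).
Hypotheses (lcY : locally_compact [set: Y]) (pY : polish R Y).
Hypotheses (mu_haar : left_haar mu) (pG : path_space Gam).
Hypothesis stable : forall y : Y, left_translate y @` Gam = Gam.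
Implicit Types zeta : {measure set (borel gam0) -> \bar R}.

Local Notation act := (act stable).
Local Notation ev := (@evalt R Y Gam gam0).

Let scY : @second_countable Y := polish_second_countable pY.
Let scG : @second_countable Gam.
Proof. by case: pG => _ _ /polish_second_countable. Qed.

Definition invariant_marginals zeta :=
  (forall y (A : set (borel gam0)), measurable A -> zeta (act y @^-1` A) = zeta A) /\
  (forall t (B : set (borel (1%g : Y))), measurable B -> zeta (ev t @^-1` B) = mu B).

Lemma measurable_evalt t : measurable_fun setT (ev t).
Proof.
exact: (@continuous_borel Gam Y gam0 1%g _ (@evalt_continuous _ _ _ pG t)).
Qed.

Lemma measurable_preimage_evalt t (B : set (borel (1%g : Y))) :
  measurable B -> measurable (ev t @^-1` B).
Proof. by move=> mB; rewrite -[X in measurable X]setTI; exact: measurable_evalt. Qed.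

Lemma measurable_act y :
  measurable_fun setT (act y : borel gam0 -> borel gam0).
Proof.
exact: (@continuous_borel Gam Gam gam0 gam0 _
  (@act_continuousr _ _ _ pG stable y)).
Qed.

Lemma measurable_act_prod : measurable_fun setT
  ((fun p : Y * Gam => act p.1 p.2) : borel (1%g : Y) * borel gam0 -> borel gam0).
Proof.
exact: (@continuous_borel_prod Y Gam Gam 1%g gam0 gam0 scY scG _
  (@act_continuous _ _ _ pG stable)).
Qed.

Lemma invariant_marginals_disintegration zeta t : invariant_marginals zeta ->
  exists nu : probability (borel gam0) R,
    nu [set g : Gam | val g t = 1%g] = 1 /\
    forall A, measurable A -> zeta A = \int[mu]_x nu (act x @^-1` A).
Proof.
move=> [izeta marg].
have sfmu := haar_sigma_finite lcY pY mu_haar.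
have imu := left_haar_invariant mu_haar.
have [E oE Efin] := haar_test_set lcY pY mu_haar.
have mE : measurable (E : set (borel (1%g : Y))) by exact: open_borel.
have /andP[E0 Eoo] : 0 < mu E < +oo.
  have := Efin 1%g; suff -> : [set y | E (y * 1)%g] = E by [].
  by apply/seteqP; split=> y /=; rewrite mulg1.
have Ef : mu E \is a fin_num by rewrite ge0_fin_numE// ltW.
(* [g |-> (g(t), g(t)^-1 g)] sends [zeta] to a measure on [Y x Gam] whose first
   factor is invariant, hence a product [mu x nu] by uniqueness of Haar measure. *)
pose theta (g : borel gam0) : borel gam0 := act (val g t)^-1%g g.
have theta_act y g : theta (act y g) = theta g.
  by rewrite /theta actE -actM invgM mulgVK.
have mPsi : measurable_fun setT (fun g : borel gam0 => (ev t g, theta g)).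
  apply: measurable_fun_pair; first exact: measurable_evalt.
  have minv : measurable_fun setT
    ((fun x : Y => x^-1)%g : borel (1%g : Y) -> borel (1%g : Y)).
    exact: (@continuous_borel Y Y 1%g 1%g _ (@invg_continuous Y)).
  exact: (measurableT_comp measurable_act_prod (measurable_fun_pair
    (measurableT_comp minv (measurable_evalt t)) (@measurable_id _ _ setT))).
have mtheta : measurable_fun setT theta.
  exact: (measurableT_comp measurable_snd mPsi).
have mthetaA (A : set (borel gam0)) : measurable A -> measurable (theta @^-1` A).
  by move=> mA; rewrite -[X in measurable X]setTI; exact: mtheta.
have mEt := measurable_preimage_evalt t mE.
(* [nu] is the law of [theta] under [zeta] conditioned on [g(t)] being in [E]. The Dirac mass is the
   default of [mnormalize] for total mass 0 or infinity, excluded by the choice of [E]. *)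
pose P0 : probability (borel gam0) R :=
  mnormalize (mrestr zeta mEt) (dirac (gam0 : borel gam0)).
pose nu := image_probability P0 mtheta.
have nuE A : nu A = zeta (theta @^-1` A `&` ev t @^-1` E) * ((fine (mu E))^-1)%:E.
  transitivity (P0 (theta @^-1` A)); first by [].
  have rT : mrestr zeta mEt (setT : set (borel gam0)) = mu E.
    by rewrite -(marg t E mE) /mrestr; congr (zeta _); exact: setTI.
  rewrite /P0 /= /mnormalize; case: ifPn => [/orP[]/eqP h|_].
  - by have : mu E = 0; [rewrite -rT; exact: h|];
    move: E0 => /[swap] ->; rewrite ltxx.
  - by have : mu E = +oo; [rewrite -rT; exact: h|];
    move: Eoo => /[swap] ->; rewrite ltxx.
  - congr (_ * _); congr (_%:E); congr (_^-1)%R; congr fine; exact: rT.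
(* For fixed [A], the left side as a function of [B] is a left invariant measure, since [theta] is
   unchanged by translation; it is therefore proportional to [mu], and [B = E] gives the factor. *)
have prod_nu (A : set (borel gam0)) (B : set (borel (1%g : Y))) :
    measurable A -> measurable B ->
    zeta (theta @^-1` A `&` ev t @^-1` B) = nu A * mu B.
  move=> mA mB.
  pose lam := image_measure (mrestr zeta (mthetaA A mA)) (measurable_evalt t).
  have lamE B' : lam B' = zeta (theta @^-1` A `&` ev t @^-1` B').
    by rewrite /lam /image_measure /= /pushforward /mrestr setIC.
  have sflam : sigma_finite setT lam.
    have [F FT Ffin] := sfmu; exists F => // n; have [mF Foo] := Ffin n.
    split=> //; rewrite lamE (le_lt_trans _ Foo)// -(marg t)//.
    have mFt := measurable_preimage_evalt t mF.
    apply: le_measure; [rewrite inE|by rewrite inE|exact: subIsetr].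
    exact: (measurableI _ _ (mthetaA _ mA) mFt).
  have ilam : left_invariant lam.
    move=> y B' mB'; rewrite !lamE.
    have mB't := measurable_preimage_evalt t mB'.
    rewrite -(izeta y _ (measurableI _ _ (mthetaA _ mA) mB't)).
    by congr (zeta _); apply/seteqP; split => g /=; rewrite theta_act.
  have := haar_unique scY sfmu sflam imu ilam mE Efin mB.
  rewrite !lamE nuE => eqE.
  rewrite -muleA [_^-1%:E * _]muleC muleA -eqE -muleA.
  by rewrite -{1}(fineK Ef) -EFinM divff ?mule1// gt_eqF// fine_gt0// E0 Eoo.
exists nu; split.
  rewrite nuE.
  rewrite (_ : theta @^-1` _ = setT); last first.
    by apply/seteqP; split=> // g _; exact: mulVg.
  by rewrite setTI marg// -{1}(fineK Ef) -EFinM divff// gt_eqF// fine_gt0// E0 Eoo.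
move=> A mA.
have sfnu : sigma_finite setT nu.
  exists (fun=> setT); first by rewrite bigcup_const.
  by move=> _; rewrite probability_setT ltry.
have := @sigma_finite_product_unique _ _ _ _ _ mu nu sfmu sfnu
  (image_measure zeta mPsi).
have mX : measurable ((fun p : Y * Gam => act p.1 p.2) @^-1` A :
    set (borel (1%g : Y) * borel gam0)).
  by rewrite -[X in measurable X]setTI; exact: measurable_act_prod.
(* The path is recovered from the pair: translating [theta g] by [g(t)] gives back [g]. *)
move=> /(_ _ _ mX) H; transitivity (image_measure zeta mPsi
    ((fun p : Y * Gam => act p.1 p.2) @^-1` A)).
  rewrite /image_measure /= /pushforward; congr (zeta _).
  by apply/seteqP; split=> g /=; rewrite /theta /evalt -actM mulgV act1.
rewrite H; last first.
  move=> B A' mB mA'; rewrite muleC -prod_nu//.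
  rewrite /image_measure /= /pushforward; congr (zeta _).
  by apply/seteqP; split=> g [].
apply: eq_integral => x _; congr (nu _).
by apply/seteqP; split=> g /=; rewrite /xsection /= inE.
Qed.

End invariant_path_measures.

(** * Past and future events, invariance under Markovianisation *)

Lemma probability_setI1 d (T : measurableType d) (R : realType)
    (P : probability T R) (A C : set T) : measurable A -> measurable C ->
  P C = 1%E -> P (A `&` C) = P A.
Proof.
move=> mA mC PC; rewrite [RHS](measureDI P mA mC).
rewrite [X in (X + _)%E](_ : _ = 0%E) ?add0e//; apply/eqP; rewrite -measure_le0.
have <- : P (~` C) = 0%E by rewrite probability_setC// PC subee.
apply: le_measure; rewrite ?inE; [exact: measurableD|exact: measurableC|].
by move=> x [].
Qed.

(** The bound on [f] makes it integrable on each [U n], where equal integrals force equality almost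
    everywhere; the countably many negligible sets are then united. *)
Lemma sigma_finite_ae_eq d (T : measurableType d) (R : realType)
    (m : {measure set T -> \bar R}) (U : (set T)^nat) (f g : T -> \bar R) :
  (forall n, measurable (U n) /\ (m (U n) < +oo)%E) -> \bigcup_n U n = setT ->
  measurable_fun setT f -> measurable_fun setT g ->
  (forall x, 0 <= f x <= 1)%E ->
  (forall B, measurable B -> \int[m]_(x in B) f x = \int[m]_(x in B) g x)%E ->
  {ae m, forall x, f x = g x}.
Proof.
move=> Uo UT mf mg f01 fg.
have ae n : ae_eq m (U n) f g.
  have [mU Uoo] := Uo n.
  apply: integral_ae_eq => //.
  - apply/integrableP; split; first exact: measurable_funTS.
    apply: (@le_lt_trans _ _ (\int[m]_(x in U n) 1)%E).
      apply: ge0_le_integral => //.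
      + exact/measurable_funTS/measurableT_comp.
      + by move=> x _; have /andP[f0 f1] := f01 x; rewrite gee0_abs.
    by rewrite integral_cst// mul1e.
  - exact: measurable_funTS.
  - by move=> B _ mB; exact: fg.
rewrite /almost_everywhere /=.
have := negligible_bigcup ae; apply: negligibleS => x /= fgx.
have [n _ Unx] : (\bigcup_n U n) x by rewrite UT.
by exists n => // /(_ Unx).
Qed.

Section restriction_events.
Context (R : realType) (Y : topologicalGroupType).
Context (Gam : set (paths R Y)) (gam0 : Gam).
Hypothesis pG : path_space Gam.
Hypothesis stable : forall y : Y, left_translate y @` Gam = Gam.
Variable I : set R.

Local Notation act := (act stable).
Local Notation restr := (@restrict_borel R Y Gam gam0 I).

Lemma measurable_restrict : measurable_fun setT restr.
Proof. by apply: open_measurable_fun => U oU; exact: open_borel. Qed.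

(* Quantifying over the translates makes this class stable under translations
   without having to translate restricted paths. *)
Definition restriction_events : set (set (borel gam0)) :=
  [set P | forall y, exists2 A, measurable A & act y @^-1` P = restr @^-1` A].

Lemma restriction_events_id P : restriction_events P ->
  exists2 A, measurable A & P = restr @^-1` A.
Proof.
move=> /(_ 1%g)[A mA PA]; exists A => //; rewrite -PA.
by apply/seteqP; split=> g /=; rewrite act1.
Qed.

Lemma measurable_restriction_events P : restriction_events P -> measurable P.
Proof.
move=> /restriction_events_id[A mA ->].
by rewrite -[X in measurable X]setTI; exact: measurable_restrict.
Qed.

Lemma restriction_events_setI : setI_closed restriction_events.
Proof.
move=> P Q eP eQ y; have [A mA PA] := eP y; have [B mB QB] := eQ y.
by exists (A `&` B); [exact: measurableI|rewrite preimage_setI PA QB].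
Qed.

Lemma restriction_eventsT : restriction_events setT.
Proof. by move=> y; exists setT; rewrite ?preimage_setT. Qed.

Lemma restriction_events_act P y : restriction_events P ->
  restriction_events (act y @^-1` P).
Proof.
move=> eP z; have [A mA PA] := eP (y * z)%g; exists A => //.
by rewrite -PA; apply/seteqP; split=> g /=; rewrite actM.
Qed.

(** Evaluation at [s] is continuous for the final topology because its composite with the
    restriction map is; a translation only replaces [B] by a translate. *)
Lemma restriction_events_eval s (B : set (borel (1%g : Y))) : I s ->
  measurable B -> restriction_events (@evalt R Y Gam gam0 s @^-1` B).
Proof.
move=> Is mB y.
pose ev (r : borel (restrict_path I gam0)) : borel (1%g : Y) :=
  val r (exist _ s (mem_set Is)).
have mev : measurable_fun setT ev.
  apply: open_measurable_fun => U oU; apply: open_borel.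
  rewrite /open /= /final_open /=.
  apply: (@open_comp Gam Y (fun g => val g s) U) => // g _.
  exact: evalt_continuous.
exists (ev @^-1` [set x : Y | B (y * x)%g]); last by [].
rewrite -[X in measurable X]setTI; apply: mev => //.
by have := measurable_mulgl y measurableT mB; rewrite setTI.
Qed.

End restriction_events.

Section markov_step.
Local Open Scope ereal_scope.
Context (R : realType) (Y : topologicalGroupType).
Variable mu : {measure set (borel (1%g : Y)) -> \bar R}.
Context (Gam : set (paths R Y)) (gam0 : Gam).
Hypotheses (lcY : locally_compact [set: Y]) (pY : polish R Y).
Hypotheses (mu_haar : left_haar mu) (pG : path_space Gam).
Hypothesis stable : forall y : Y, left_translate y @` Gam = Gam.
Implicit Types zeta : {measure set (borel gam0) -> \bar R}.

Local Notation act := (act stable).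
Local Notation ev := (@evalt R Y Gam gam0).
Local Notation invariant_marginals := (invariant_marginals mu stable).

Let scY : @second_countable Y := polish_second_countable pY.

Local Notation past_events t :=
  (@restriction_events R Y Gam gam0 stable (past t)).
Local Notation future_events t :=
  (@restriction_events R Y Gam gam0 stable (future t)).

Lemma closed_eval_eq t (x : Y) : closed [set g : Gam | val g t = x].
Proof.
apply: (@preimage_closed Gam Y (fun g => val g t) [set x]).
  by move=> g _; exact: evalt_continuous.
by apply/accessible_closed_set1/hausdorff_accessible/(polish_hausdorff pY).
Qed.

Lemma measurable_eval_eq t (x : Y) :
  measurable ([set g : Gam | val g t = x] : set (borel gam0)).
Proof. by apply: closed_borel; exact: closed_eval_eq. Qed.

Lemma probability_eval_setI (p : probability (borel gam0) R) t x
    (A : set (borel gam0)) (B : set (borel (1%g : Y))) :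
  p [set g : Gam | val g t = x] = 1 -> measurable A -> measurable B ->
  p (A `&` ev t @^-1` B) = p A * (\1_B x)%:E.
Proof.
move=> px mA mB; have mC := measurable_eval_eq t x.
have mAB := measurableI _ _ mA (measurable_preimage_evalt pG t mB).
rewrite -(probability_setI1 mAB mC px) indicE; have [xB|xB] := boolP (x \in B).
  rewrite mule1 -(probability_setI1 mA mC px); congr (p _).
  apply/seteqP; split=> g [] /=; first by move=> [].
  move=> Ag gx; split=> //; split=> //; have := set_mem xB.
  by rewrite -gx.
rewrite mule0 [X in p X](_ : _ = set0) ?measure0//.
apply/seteqP; split=> // g [/= [_ Bg] gx].
by move/negP: xB; apply; apply/mem_set; rewrite -gx.
Qed.

Lemma translate_probability (nu : probability (borel gam0) R) t x :
  nu [set g : Gam | val g t = 1%g] = 1 ->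
  nu (act x @^-1` [set g : Gam | val g t = x]) = 1.
Proof.
move=> <-; congr (nu _); apply/seteqP; split=> g /=.
  move=> xg; apply: (can_inj (mulKg x)); rewrite mulg1; exact: xg.
by move=> g1; rewrite -[RHS]mulg1 -g1.
Qed.

Lemma measurable_translate (nu : probability (borel gam0) R)
    (A : set (borel gam0)) : measurable A ->
  measurable_fun setT (fun x : borel (1%g : Y) => nu (act x @^-1` A)).
Proof.
move=> mA.
have sfnu : sigma_finite setT nu.
  exists (fun=> setT); first by rewrite bigcup_const.
  by move=> _; rewrite probability_setT ltry.
have mX : measurable ((fun p : Y * Gam => act p.1 p.2) @^-1` A :
    set (borel (1%g : Y) * borel gam0)).
  by rewrite -[X in measurable X]setTI; exact: measurable_act_prod.
have := sigma_finite_measurable_xsection sfnu mX.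
congr measurable_fun; apply/funext => x; congr (nu _).
by apply/seteqP; split=> g /=; rewrite /xsection /= inE.
Qed.

(** Evaluating [zeta] on the paths of [P] with [g(t)] in [B] localises both mixtures to [B], since
    the fibre measures are concentrated on [g(t) = x]. *)
Lemma disintegration_unique zeta t (kappa : Y -> vague_probability R gam0)
    (nu : probability (borel gam0) R) P :
  (forall x : Y, kappa x [set g : Gam | val g t = x] = 1) ->
  (forall A, measurable A -> measurable_fun setT
    (fun x : borel (1%g : Y) => kappa x A)) ->
  (forall A, measurable A -> zeta A = \int[mu]_x kappa x A) ->
  nu [set g : Gam | val g t = 1%g] = 1 ->
  (forall A, measurable A -> zeta A = \int[mu]_x nu (act x @^-1` A)) ->
  measurable P ->
  {ae mu, forall x, kappa x P = nu (act x @^-1` P)}.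
Proof.
move=> kt mk zk nu1 znu mP.
have [U Uo UT] := haar_open_cover lcY pY mu_haar.
apply: (@sigma_finite_ae_eq _ _ _ mu U) => //.
- by move=> n; have [oU ?] := Uo n; split => //; exact: open_borel.
- exact: mk.
- exact: measurable_translate.
- by move=> x; rewrite measure_ge0 probability_le1.
move=> B mB.
have mPB := measurableI _ _ mP (measurable_preimage_evalt pG t mB).
rewrite [LHS]integral_mkcond [RHS]integral_mkcond !epatch_indic.
transitivity (zeta (P `&` ev t @^-1` B)); [rewrite zk//|rewrite znu//];
  apply: eq_integral => x _ /=.
- by rewrite (@probability_eval_setI _ t x).
- have := @probability_eval_setI (image_probability nu
    (measurable_act pG stable x)) t x P B.
  by move=> <-//; exact: translate_probability.
Qed.

Lemma is_markovianisation_invariant t zeta zeta' : invariant_marginals zeta ->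
  is_markovianisation mu t zeta zeta' -> invariant_marginals zeta'.
Proof.
move=> izeta [kappa [kappa' [[bk kt zk] bk' ck' zk']]].
have sT := msupp_haar pY mu_haar.
rewrite /borel_family /mixture sT in bk kt zk bk' ck' zk'.
have {}kt x := kt x Logic.I; have {}ck' x := ck' x Logic.I.
have [nu [nu1 znu]] := invariant_marginals_disintegration lcY pY mu_haar pG t izeta.
have [_ marg] := izeta.
have kappa'E x P F : past_events t P ->
    future_events t F ->
    kappa' x (P `&` F) = kappa x P * kappa x F.
  move=> /restriction_events_id[A mA ->] /restriction_events_id[B mB ->].
  have := ck' x _ (measurableX mA mB).
  have := product_measure1E
    (image_probability (kappa x) (@measurable_restrict R Y Gam gam0 (past t)))
    (image_probability (kappa x) (@measurable_restrict R Y Gam gam0 (future t)))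
    mA mB.
  by move=> kAB ck; apply: etrans kAB; exact: ck.
have zeta'E P F : past_events t P ->
    future_events t F ->
    zeta' (P `&` F) = \int[mu]_x (kappa x P * kappa x F).
  move=> eP eF; rewrite zk'; last first.
    by apply: measurableI; apply: measurable_restriction_events; eassumption.
  by apply: eq_integral => x _; exact: kappa'E.
(* Each [s] lies on one side of [t], so that the event is a past or a future one and the other
   factor is [setT], of mass 1. *)
have marg' s (B : set (borel (1%g : Y))) : measurable B ->
    zeta' (ev s @^-1` B) = mu B.
  move=> mB; rewrite -(marg s)// zk; last exact: measurable_preimage_evalt.
  have [st|/ltW ts] := leP s t.
  - have es : past_events t (ev s @^-1` B).
      by apply: restriction_events_eval => //; rewrite /past set_itvE.
    rewrite -[X in zeta' X]setIT zeta'E//; last exact: restriction_eventsT.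
    by apply: eq_integral => x _; rewrite probability_setT mule1.
  - have es : future_events t (ev s @^-1` B).
      by apply: restriction_events_eval => //; rewrite /future set_itvE.
    rewrite -[X in zeta' X]setTI zeta'E//; last exact: restriction_eventsT.
    by apply: eq_integral => x _; rewrite probability_setT mul1e.
split; last exact: marg'.
move=> y A mA.
pose G := [set C | exists P F, [/\ past_events t P,
  future_events t F & C = P `&` F]].
have [U Uo UT] := haar_open_cover lcY pY mu_haar.
have mU n : measurable (U n : set (borel (1%g : Y))).
  by apply: open_borel; have [] := Uo n.
(* These members of the pi-system have finite mass and exhaust [Gam], as [measure_unique] requires
   for measures that may be infinite. *)
have evU n : G (ev t @^-1` U n).
  exists (ev t @^-1` U n), setT; rewrite setIT; split => //.
  - by apply: restriction_events_eval => //; rewrite /past set_itvE /=.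
  - exact: restriction_eventsT.
have zeta'h P F : past_events t P -> future_events t F ->
    zeta' (P `&` F) = \int[mu]_x (nu (act x @^-1` P) * nu (act x @^-1` F)).
  move=> eP eF; rewrite zeta'E//.
  have mP := measurable_restriction_events eP.
  have mF := measurable_restriction_events eF.
  apply: ge0_ae_eq_integral => //.
  - by apply: emeasurable_funM; exact: bk.
  - by apply: emeasurable_funM; exact: measurable_translate.
  - by move=> x _; exact: mule_ge0.
  - by move=> x _; exact: mule_ge0.
  - have aeP := disintegration_unique kt bk zk nu1 znu mP.
    have aeF := disintegration_unique kt bk zk nu1 znu mF.
    have aePF := @filterI _ _ (ae_filter_ringOfSetsType mu) _ _ aeP aeF.
    by apply: filterS aePF => x [-> ->].
have zeta'G C : G C -> zeta' (act y @^-1` C) = zeta' C.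
  move=> [P [F [eP eF ->]]]; rewrite preimage_setI !zeta'h//;
    [|exact: restriction_events_act|exact: restriction_events_act].
  have mP := measurable_restriction_events eP.
  have mF := measurable_restriction_events eF.
  (* Translating both events by [y] replaces [x] by [y * x] in the integrand, and left invariance of
     [mu] absorbs this. *)
  rewrite -[RHS](@left_invariant_integral _ _ mu _ y)//.
  - by apply: eq_integral => x _; congr (nu _ * nu _);
      apply/seteqP; split=> g /=; rewrite actM.
  - exact: left_haar_invariant.
  - by apply: emeasurable_funM; exact: measurable_translate.
  - by move=> x; exact: mule_ge0.
rewrite -[LHS]/(image_measure zeta' (measurable_act pG stable y) A).
apply: (@measure_unique _ R (borel gam0) G (fun n => ev t @^-1` U n) _ _ _ _
  (image_measure zeta' (measurable_act pG stable y)) zeta') => //.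
- apply/seteqP; split; last first.
    apply: smallest_sub; first exact: sigma_algebra_measurable.
    move=> _ [P [F [eP eF ->]]].
    by apply: measurableI; apply: measurable_restriction_events; eassumption.
  rewrite (borel_path_cylinder pG).
  apply: smallest_sub; first exact: smallest_sigma_algebra.
  move=> _ [s [V [oV ->]]]; apply: sub_sigma_algebra.
  have mV : measurable (V : set (borel (1%g : Y))) by exact: open_borel.
  have [st|/ltW ts] := leP s t.
  - exists (ev s @^-1` V), setT; rewrite setIT; split=> //.
      by apply: restriction_events_eval => //; rewrite /past set_itvE.
    exact: restriction_eventsT.
  - exists setT, (ev s @^-1` V); rewrite setTI; split=> //.
      exact: restriction_eventsT.
    by apply: restriction_events_eval => //; rewrite /future set_itvE.
- move=> _ _ [P [F [eP eF ->]]] [P' [F' [eP' eF' ->]]].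
  exists (P `&` P'), (F `&` F'); rewrite setIACA.
  by split=> //; exact: restriction_events_setI.
- by rewrite -preimage_bigcup UT preimage_setT.
- move=> n; rewrite [X in X < _](zeta'G _ (evU n)) marg'//.
  by have [] := Uo n.
Qed.

End markov_step.

(** * Vague limits of probability measures *)

(** The part of [K] outside [V] is compact and inside [U], so by regularity finitely many open sets
    with closure in [U] cover it. [K1] is cut out by their closures and [K2] is what the open sets
    leave. *)
Lemma compact_split (T : topologicalType) (K U V : set T) :
  hausdorff_space T -> regular_space T -> compact K -> open U -> open V ->
  K `<=` U `|` V ->
  exists K1 K2 : set T, [/\ compact K1, compact K2, K1 `<=` U, K2 `<=` V &
    K `<=` K1 `|` K2].
Proof.
move=> hT rT cK oU oV KUV.
(* The point [p] makes [T] a pointed type, over which [cover_compact] is stated. *)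
have [->|/set0P[p _]] := eqVneq K set0.
  by exists set0, set0; split=> //; exact: compact0.
have kK := compact_closed hT cK.
have cKV : compact (K `&` ~` V).
  by apply: (subclosed_compact _ cK) => //; apply: closedI => //; exact: open_closedC.
pose Q x := [set W : set T | [/\ open W, W x & closure W `<=` U]].
pose f x := xget set0 (Q x).
have Qf x : (K `&` ~` V) x -> Q x (f x).
  move=> [Kx Vx]; have Ux : U x by case: (KUV x Kx).
  have [B Bx BU] := rT x U (open_nbhs_nbhs (conj oU Ux)).
  apply: (@xgetPex _ set0 (Q x)); exists B^°; split.
  - exact: open_interior.
  - exact: nbhs_singleton (nbhs_interior Bx).
  - by apply: subset_trans BU; apply: closureS; exact: interior_subset.
have : @cover_compact (pointed_at p) (K `&` ~` V) by rewrite -compact_cover.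
move=> /(_ T (K `&` ~` V) f)[||D DK KD]; first by move=> x /Qf[].
  by move=> x Kx; exists x => //; have [_ fx _] := Qf x Kx.
pose C := \bigcup_(x in [set` D]) closure (f x).
have kC : closed C.
  by apply: closed_bigcup => // x _; exact: closed_closure.
have oD : open (\bigcup_(x in [set` D]) f x).
  by apply: bigcup_open => x /= /DK; rewrite inE => /Qf[].
exists (K `&` C), (K `&` ~` \bigcup_(x in [set` D]) f x); split.
- by apply: (subclosed_compact _ cK) => //; exact: closedI.
- apply: (subclosed_compact _ cK) => //; apply: closedI => //.
  exact: open_closedC.
- by move=> x [_ [z /= /DK + fzx]]; rewrite inE => /Qf[_ _]; apply.
- move=> x [Kx nfx]; apply: contrapT => Vx.
  by apply: nfx; exact: KD.
- move=> x Kx; have [fx|nfx] := pselect ((\bigcup_(z in [set` D]) f z) x).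
    left; split=> //; have [z Dz fzx] := fx; exists z => //.
    exact: subset_closure.
  by right.
Qed.

(* A finitely additive content on compact sets is turned into a measure by inner
   regularity on open sets and outer regularity elsewhere. *)
Section compact_content.
Local Open Scope ereal_scope.
Context (R : realType) (T : topologicalType) (x0 : T).
Hypotheses (hT : hausdorff_space T) (rT : regular_space T).
Variable m : set T -> R.
Hypothesis m0 : m set0 = 0%R.
Hypothesis m_le1 : forall K, compact K -> (m K <= 1)%R.
Hypothesis m_mono : forall K K', compact K -> compact K' -> K `<=` K' ->
  (m K <= m K')%R.
Hypothesis m_disj : forall K K', compact K -> compact K' -> K `&` K' = set0 ->
  m (K `|` K') = (m K + m K')%R.
Hypothesis m_sub : forall K K', compact K -> compact K' ->
  (m (K `|` K') <= m K + m K')%R.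

Definition inner_content (A : set T) : \bar R :=
  ereal_sup [set (m K)%:E | K in [set K | compact K /\ K `<=` A]].

Definition content_measure (A : set (pointed_at x0)) : \bar R :=
  ereal_inf [set inner_content U | U in [set U : set T | open U /\ A `<=` U]].

Local Notation lam := inner_content.
Local Notation M := content_measure.

Lemma inner_content_ub K A : compact K -> K `<=` A -> (m K)%:E <= lam A.
Proof. by move=> cK KA; apply: ereal_sup_ubound; exists K. Qed.

Lemma inner_content_ge0 A : 0 <= lam A.
Proof.
by rewrite -[0](congr1 EFin m0); apply: inner_content_ub => //; exact: compact0.
Qed.

Lemma inner_content_le A x : (forall K, compact K -> K `<=` A -> (m K)%:E <= x) ->
  lam A <= x.
Proof. by move=> h; apply: ge_ereal_sup => _ [K [cK KA] <-]; exact: h. Qed.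

Lemma inner_content_le1 A : lam A <= 1.
Proof. by apply: inner_content_le => K cK _; rewrite lee_fin m_le1. Qed.

Lemma inner_content_mono A B : A `<=` B -> lam A <= lam B.
Proof.
move=> AB; apply: inner_content_le => K cK KA.
by apply: inner_content_ub => //; exact: subset_trans AB.
Qed.

Lemma inner_content_fin_cover (U : (set T)^nat) n K : (forall i, open (U i)) ->
  compact K -> K `<=` \bigcup_(i < n) U i -> (m K)%:E <= \sum_(i < n) lam (U i).
Proof.
move=> oU; elim: n K => [|n IH] K cK.
  by rewrite bigcup_mkord !big_ord0 subset0 => ->; rewrite m0.
rewrite bigcup_mkord big_ord_recr /= -bigcup_mkord => KU.
have oV : open (\bigcup_(i < n) U i) by apply: bigcup_open => i _; exact: oU.
have [K1 [K2 [cK1 cK2 K1V K2U KK]]] := compact_split hT rT cK oV (oU n) KU.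
rewrite big_ord_recr /=; apply: (@le_trans _ _ ((m K1)%:E + (m K2)%:E)).
  rewrite -EFinD lee_fin; apply: le_trans (m_sub cK1 cK2).
  by apply: m_mono => //; exact: compactU.
by apply: leeD; [exact: IH|exact: inner_content_ub].
Qed.

Lemma inner_content_bigcup (U : (set T)^nat) : (forall i, open (U i)) ->
  lam (\bigcup_i U i) <= \sum_(i <oo) lam (U i).
Proof.
move=> oU; apply: inner_content_le => K cK KU.
have [n _ Kn] : \forall n \near \oo, K `<=` \bigcup_(i < n) U i.
  have /compact_near_coveringP := cK; apply => x Kx.
  have [i _ Uix] := KU x Kx.
  exists (U i, [set n | (i < n)%N]) => /=.
    by split; [exact: open_nbhs_nbhs|exact: nbhs_infty_gt].
  by move=> [z n] [/= Uiz iN]; exists i.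
have {}Kn := Kn n (leqnn n).
apply: le_trans (inner_content_fin_cover oU cK Kn) _.
rewrite -(big_mkord xpredT (fun i => lam (U i))).
by apply: nneseries_lim_ge => *; exact: inner_content_ge0.
Qed.

Lemma content_measure_open U : open U -> M U = lam U.
Proof.
move=> oU; apply/eqP; rewrite eq_le; apply/andP; split.
  by apply: ereal_inf_lbound; exists U => //; split.
by apply: le_ereal_inf_tmp => _ [V [oV UV] <-]; exact: inner_content_mono.
Qed.

Lemma content_measure_le A U : open U -> A `<=` U -> M A <= lam U.
Proof. by move=> oU AU; apply: ereal_inf_lbound; exists U. Qed.

Lemma content_measure_compact K : compact K -> (m K)%:E <= M K.
Proof.
move=> cK; apply: le_ereal_inf_tmp => _ [U [oU KU] <-].
exact: inner_content_ub.
Qed.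

Let M0 : M set0 = 0.
Proof.
rewrite content_measure_open; last exact: open0.
apply/eqP; rewrite eq_le inner_content_ge0 andbT.
by apply: inner_content_le => K cK; rewrite subset0 => ->; rewrite m0.
Qed.

Let M_ge0 A : 0 <= M A.
Proof. by apply: le_ereal_inf_tmp => _ [U _ <-]; exact: inner_content_ge0. Qed.

Let M_le A B : A `<=` B -> M A <= M B.
Proof.
move=> AB; apply: le_ereal_inf_tmp => _ [U [oU BU] <-].
by apply: content_measure_le => //; exact: subset_trans BU.
Qed.

Let M_fin A : M A \is a fin_num.
Proof.
rewrite ge0_fin_numE//; apply: (@le_lt_trans _ _ 1); last exact: ltry.
apply: le_trans (inner_content_le1 setT).
by apply: content_measure_le => //; exact: openT.
Qed.

Let M_sub : sigma_subadditive M.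
Proof.
move=> F; apply/lee_addgt0Pr => e e0.
have := epsilon_trick (A := M \o F) xpredT (fun n => M_ge0 (F n)) (ltW e0).
apply: le_trans.
have : forall n, exists U, [/\ open U, F n `<=` U &
    lam U <= M (F n) + (e / (2 ^ n.+1)%:R)%:E].
  move=> n; have en : (0 < e / (2 ^ n.+1)%:R)%R by rewrite divr_gt0// ltr0n expn_gt0.
  have [_ [U [oU FU] <-] /ltW lU] := lb_ereal_inf_adherent en (M_fin (F n)).
  by exists U.
move=> /choice[U hU].
apply: (@le_trans _ _ (lam (\bigcup_n U n))).
  apply: content_measure_le.
    by apply: bigcup_open => n _; have [] := hU n.
  by apply: subset_bigcup => n _; have [] := hU n.
apply: (@le_trans _ _ (\sum_(n <oo) lam (U n))).
  by apply: inner_content_bigcup => n; have [] := hU n.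
apply: lee_nneseries => [n _ _|n _]; first exact: inner_content_ge0.
by have [] := hU n.
Qed.

HB.instance Definition _ := isOuterMeasure.Build R (pointed_at x0) M
  M0 M_ge0 M_le M_sub.

(** For an open [U] containing [X], take a compact [K] in [U] and [V], then a compact [K'] in [U]
    minus [K]. They are disjoint, so [m K + m K'] is at most [lam U], while [X] minus [V] lies in
    [U] minus [K]. Suprema are taken over [K'] first, then over [K]. *)
Lemma content_measure_caratheodory (V : set T) : open V ->
  caratheodory_measurable M (V : set (pointed_at x0)).
Proof.
move=> oV; apply: le_caratheodory_measurable => X.
apply: le_ereal_inf_tmp => _ [U [oU XU] <-].
have h1 : M (X `&` V) <= lam (U `&` V).
  by apply: content_measure_le; [exact: openI|exact: setSI].
apply: le_trans (leeD2r _ h1) _.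
rewrite -leeBrDr//; apply: inner_content_le => K cK KUV.
rewrite leeBrDr// addrC -leeBrDr//.
apply: (@le_trans _ _ (lam (U `&` ~` K))).
  apply: content_measure_le.
    by apply: openI => //; apply: closed_openC; exact: compact_closed.
  by move=> x [Xx Vx]; split; [exact: XU|move=> /KUV[]].
apply: inner_content_le => K' cK' K'U; rewrite leeBrDr// -EFinD -m_disj//.
  apply: inner_content_ub; first exact: compactU.
  by move=> x [/K'U[]//|/KUV[]].
by apply/seteqP; split => // x [/K'U[_ nK] /nK].
Qed.

Lemma borel_caratheodory (A : set (borel x0)) : measurable A ->
  caratheodory_measurable M (A : set (pointed_at x0)).
Proof.
apply: smallest_sub; last by move=> V; exact: content_measure_caratheodory.
exact: (@sigma_algebra_measurable _ (caratheodory_type M)).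
Qed.

(** The inequality on compact sets can be strict: mass that approaches [K] from outside counts in
    [P K] but not in [m K]. *)
Lemma content_measure_exists : exists2 P : {measure set (borel x0) -> \bar R},
  (forall U : set T, open U -> P U = lam U) &
  (forall K : set T, compact K -> (m K)%:E <= P K).
Proof.
have sa : semi_sigma_additive (M : set (borel x0) -> \bar R).
  move=> F mF tF mUF.
  apply: (@caratheodory_measure_sigma_additive R (pointed_at x0) M) => //.
  - by move=> i; exact: borel_caratheodory.
  - exact: borel_caratheodory.
pose b := isMeasure.Build _ _ _ (M : set (borel x0) -> \bar R) M0 M_ge0 sa.
pose P := HB.pack_for {measure set (borel x0) -> \bar R}
  (M : set (borel x0) -> \bar R) b.
exists P; [exact: content_measure_open|exact: content_measure_compact].
Qed.

End compact_content.

Lemma ultra_cvg (S : Type) (X : topologicalType) (G : set_system S)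
    (f : S -> X) (K : set X) : UltraFilter G -> compact K ->
  (\forall s \near G, K (f s)) -> exists2 l, K l & f @ G --> l.
Proof.
move=> UG cK GK; have [l [Kl cl]] := cK (f @ G) _ GK.
exists l => // A lA; have [//|nA] := in_ultra_setVsetC (f @^-1` A) UG.
by have [z [/= nAz Az]] := cl (~` A) A nA lA.
Qed.

(** * Layer-cake sums *)

Section layers.
Context d (T : measurableType d) (R : realType).
Implicit Types (p : probability T R) (f : T -> R).

Lemma probability_integrable p f M : measurable_fun setT f ->
  (forall x, `|f x| <= M) -> p.-integrable setT (EFin \o f).
Proof.
move=> mf fM; apply: measurable_bounded_integrable => //.
  by rewrite (le_lt_trans (probability_le1 p _))// ltry.
exists M; split; first by rewrite num_real.
by move=> M' MM' x _; exact: le_trans (fM x) (ltW MM').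
Qed.

(** The sum counts the integers from 1 to [n] that are at most [y], that is, the floor of [y] capped
    at [n]. The first half serves the induction step of the second when [y] is at least [n]. *)
Lemma sum_indicator_levels (n : nat) (y : R) :
  (n%:R <= y -> \sum_(k < n) (k.+1%:R <= y)%R%:R = n%:R :> R) /\
  (0 <= y <= n%:R ->
    \sum_(k < n) (k.+1%:R <= y)%R%:R <= y <= 1 + \sum_(k < n) (k.+1%:R <= y)%R%:R).
Proof.
elim: n => [|n [IH1 IH2]]; rewrite ?big_ord0 ?big_ord_recr /=.
  by split=> // /andP[? ?]; lra.
have nS : n%:R <= n.+1%:R :> R by rewrite ler_nat.
split=> [ny|/andP[y0 yn]].
  by rewrite ny IH1 ?natr1// (le_trans nS).
have [ny|ny] := leP n.+1%:R y.
  have -> : y = n.+1%:R by apply/eqP; rewrite eq_le yn ny.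
  rewrite /=; move: IH1 => /(_ (le_trans nS ny)).
  have yE : y = n.+1%:R by apply/eqP; rewrite eq_le yn ny.
  by rewrite yE => ->; rewrite natr1; lra.
rewrite addr0; have [yn'|/ltW ny'] := leP y n%:R; first by apply: IH2; rewrite y0.
rewrite (IH1 ny') ny' /=; move: ny; rewrite -natr1; lra.
Qed.

(* Riemann sum of the layer-cake formula. Its terms are masses of closed sets,
   whose limits are controlled by the limit measure. *)
Definition layer_sum p f (n : nat) : R :=
  n%:R^-1 * \sum_(k < n) fine (p [set x | k.+1%:R <= n%:R * f x]).

(** With [s n x] the number of levels [k/n], [k] from 1 to [n], reached by [f x], the value [f x]
    lies between [s n x / n] and [(s n x + 1) / n]; integrate. *)
Lemma layer_bounds p f n : measurable_fun setT f -> (forall x, 0 <= f x <= 1) ->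
  (0 < n)%N ->
  layer_sum p f n <= \int[p]_x f x <= n%:R^-1 + layer_sum p f n.
Proof.
move=> mf f01 n0; have n0' : 0 < n%:R :> R by rewrite ltr0n.
pose D (k : nat) := [set x | k.+1%:R <= n%:R * f x].
have mD k : measurable (D k).
  rewrite -[D k]setTI.
  apply: (@measurable_fun_le _ _ R setT (cst k.+1%:R)
    (fun x => n%:R * f x)) => //.
  by apply: measurable_funM => //.
pose s j x : R := \sum_(k < j) \1_(D k) x.
have ms j : measurable_fun setT (s j).
  by apply: measurable_sum => k; exact: measurable_indic.
have s_ge0 j x : 0 <= s j x by apply: sumr_ge0 => k _.
have s_le j x : `|s j x| <= j%:R.
  rewrite ger0_norm// /s [leRHS](_ : _ = \sum_(k < j) 1); last first.
    by rewrite sumr_const card_ord.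
  by apply: ler_sum => k _; rewrite indicE; case: (_ \in _).
have is_ j : p.-integrable setT (EFin \o s j).
  exact: (probability_integrable p (ms j) (s_le j)).
have Is j : \int[p]_x s j x = \sum_(k < j) fine (p (D k)).
  elim: j => [|j IH]; rewrite ?big_ord0 ?big_ord_recr.
    under eq_Rintegral do rewrite /s big_ord0.
    by rewrite Rintegral_cst// mul0r.
  under eq_Rintegral do rewrite /s big_ord_recr.
  have i1 : p.-integrable setT (EFin \o (\1_(D j) : T -> R)).
    apply: (@probability_integrable p _ 1); first exact: measurable_indic.
    by move=> x; rewrite indicE; case: (_ \in _); rewrite ?normr1 ?normr0.
  rewrite (@RintegralD _ _ _ p setT (s j) _ measurableT (is_ j) i1) IH.
  by congr (_ + _); rewrite /Rintegral integral_indic// setIT.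
have sE x : s n x = \sum_(k < n) (k.+1%:R <= n%:R * f x)%R%:R.
  apply: eq_bigr => k _; rewrite indicE; congr (nat_of_bool _)%:R.
  by apply/idP/idP; rewrite inE.
have sf x : n%:R^-1 * s n x <= f x <= n%:R^-1 + n%:R^-1 * s n x.
  have [_ /(_ _)] := sum_indicator_levels n (n%:R * f x).
  have /andP[f0 f1] := f01 x.
  rewrite -sE mulr_ge0 ?ler_piMr// => /(_ isT)/andP[h1 h2].
  rewrite -(ler_pM2l n0') mulrA divff ?gt_eqF// mul1r h1 /=.
  by rewrite -(ler_pM2l n0') mulrDr mulrA divff ?gt_eqF// mul1r.
have i_f : p.-integrable setT (EFin \o f).
  apply: (@probability_integrable p f 1) => // x.
  by have /andP[f0 f1] := f01 x; rewrite ger0_norm.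
have i_s : p.-integrable setT (EFin \o (fun x => n%:R^-1 * s n x)).
  apply: (@probability_integrable p _ 1); first exact: measurable_funM.
  move=> x; rewrite ger0_norm ?mulr_ge0 ?invr_ge0//.
  by have /andP[+ _] := sf x => /le_trans; apply; have /andP[] := f01 x.
have i_s' : p.-integrable setT (EFin \o (fun x => n%:R^-1 + n%:R^-1 * s n x)).
  apply: (@probability_integrable p _ (n%:R^-1 + 1)).
    by apply: measurable_funD => //; exact: measurable_funM.
  move=> x; rewrite ger0_norm ?addr_ge0 ?mulr_ge0 ?invr_ge0// lerD2l.
  by have /andP[+ _] := sf x => /le_trans; apply; have /andP[] := f01 x.
have Ins : \int[p]_x (n%:R^-1 * s n x) = layer_sum p f n.
  by rewrite RintegralZl// Is.
apply/andP; split.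
  by rewrite -Ins; apply: le_Rintegral => // x _; have /andP[] := sf x.
rewrite -Ins.
apply: (@le_trans _ _ (\int[p]_x (n%:R^-1 + n%:R^-1 * s n x))).
  by apply: le_Rintegral => // x _; have /andP[] := sf x.
rewrite RintegralD//; last first.
  by apply: (@probability_integrable p _ `|n%:R^-1|).
by rewrite Rintegral_cst// [X in fine X](probability_setT p) mulr1.
Qed.

End layers.

Lemma measure_probability d (T : measurableType d) (R : realType)
    (m : {measure set T -> \bar R}) : m setT = 1%E ->
  exists P : probability T R, forall A, P A = m A.
Proof.
move=> mT; exists (mnormalize m (dirac point)) => A; rewrite /= /mnormalize.
case: ifPn => [/orP[]/eqP mT'|_].
- by have := mT; rewrite [LHS]mT' => /eqP; rewrite eqe eq_sym oner_eq0.
- by have := mT; rewrite [LHS]mT'.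
- by rewrite [X in fine X]mT /= invr1 mule1.
Qed.

(** * Limits of tight measures along an ultrafilter *)

Section tight_ultrafilter.
Context (R : realType) (T : topologicalType) (x0 : T).
Hypotheses (hT : hausdorff_space T) (rT : regular_space T).
Variable G : set_system (vague_probability R x0).
Hypothesis UG : UltraFilter G.
Variable C : set T.
Hypothesis cC : compact C.
Hypothesis GC : \forall p \near G, (p : probability (borel x0) R) C = 1%E.

Let compact_borel (K : set T) : compact K -> measurable (K : set (borel x0)).
Proof. by move=> cK; apply: closed_borel; exact: compact_closed. Qed.

Let mass (p : vague_probability R x0) (A : set (borel x0)) : R := fine (p A).

Let mass_ge0 p A : 0 <= mass p A. Proof. exact: fine_ge0. Qed.

Let mass_le1 p A : measurable A -> mass p A <= 1.
Proof.
move=> mA; rewrite -lee_fin fineK ?probability_le1//.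
by rewrite ge0_fin_numE// (le_lt_trans (probability_le1 p mA))// ltry.
Qed.

Let massE (p : vague_probability R x0) (A : set (borel x0)) :
  measurable A -> p A = (mass p A)%:E.
Proof.
move=> mA; rewrite fineK// ge0_fin_numE//.
by rewrite (le_lt_trans (probability_le1 p mA))// ltry.
Qed.

(** Along an ultrafilter the masses of every Borel set converge, being in [[0, 1]]. The limit is
    finitely additive but need not be sigma-additive. *)
Definition limit_mass (A : set (borel x0)) : R := lim (mass p A @[p --> G]).

Local Notation m := limit_mass.

Lemma limit_mass_cvg A : measurable A -> mass p A @[p --> G] --> m A.
Proof.
move=> mA; have [l _ Gl] : exists2 l, [set` `[0, 1]] l &
    mass p A @[p --> G] --> (l : R).
  apply: ultra_cvg => //; first exact: segment_compact.
  by near=> p; rewrite /= in_itv /= mass_ge0 mass_le1.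
by apply: cvgP Gl.
Unshelve. all: end_near. Qed.

Lemma limit_mass_le A B : measurable A -> measurable B -> A `<=` B -> m A <= m B.
Proof.
move=> mA mB AB; apply: (ler_cvg_to (limit_mass_cvg mA) (limit_mass_cvg mB)).
near=> p; rewrite -lee_fin -!massE//; apply: le_measure => //; rewrite inE//.
Unshelve. all: end_near. Qed.

Lemma limit_massU A B : measurable A -> measurable B -> A `&` B = set0 ->
  m (A `|` B) = m A + m B.
Proof.
move=> mA mB AB; apply: (cvg_unique _ (limit_mass_cvg (measurableU _ _ mA mB))).
  exact: Rhausdorff.
apply: cvg_trans (cvgD (limit_mass_cvg mA) (limit_mass_cvg mB)).
apply: near_eq_cvg; near=> p; apply: EFin_inj; rewrite EFinD -!massE//.
  by rewrite measureU.
exact: measurableU.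
Unshelve. all: end_near. Qed.

Lemma limit_massU_le A B : measurable A -> measurable B ->
  m (A `|` B) <= m A + m B.
Proof.
move=> mA mB; have mAB := measurableU _ _ mA mB.
apply: (ler_cvg_to (limit_mass_cvg mAB)
  (cvgD (limit_mass_cvg mA) (limit_mass_cvg mB))).
near=> p; rewrite -lee_fin EFinD -!massE//; exact: measureU2.
Unshelve. all: end_near. Qed.

Lemma limit_mass_setI (A : set (borel x0)) : measurable A -> m (A `&` C) = m A.
Proof.
move=> mA; have mAC := measurableI _ _ mA (compact_borel cC).
apply: (cvg_unique _ (limit_mass_cvg mAC)).
  exact: Rhausdorff.
apply: cvg_trans (limit_mass_cvg mA); apply: near_eq_cvg; near=> p.
rewrite /mass probability_setI1//; first exact: compact_borel.
by near: p.
Unshelve. all: end_near. Qed.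

(** Tightness enters twice: [m C = 1] gives [P] total mass 1, and [m D] is the value of [m] on the
    compact set [D] cut by [C], which extends the bound from compact to closed sets. *)
Lemma tight_limit_exists : exists2 P : probability (borel x0) R,
  (forall U : set T, open U -> P U = inner_content m U) &
  (forall D : set T, closed D -> ((m D)%:E <= P D)%E).
Proof.
have m0 : m set0 = 0.
  apply: (cvg_unique _ (limit_mass_cvg measurable0)); first exact: Rhausdorff.
  apply: cvg_near_cst; near=> p.
  by rewrite /mass measure0.
have mT : m setT = 1.
  apply: (cvg_unique _ (limit_mass_cvg measurableT)); first exact: Rhausdorff.
  apply: cvg_near_cst; near=> p.
  by rewrite /mass probability_setT.
have m1 K : compact K -> m K <= 1.
  by move=> cK; rewrite -mT; apply: limit_mass_le => //; exact: compact_borel.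
have [P PU PK] := @content_measure_exists R T x0 hT rT m m0 m1
  (fun K K' cK cK' => limit_mass_le (compact_borel cK) (compact_borel cK'))
  (fun K K' cK cK' => limit_massU (compact_borel cK) (compact_borel cK'))
  (fun K K' cK cK' => limit_massU_le (compact_borel cK) (compact_borel cK')).
have PT : P setT = 1%E.
  apply/eqP; rewrite eq_le; apply/andP; split.
    by rewrite (PU _ openT); exact: inner_content_le1.
  apply: (@le_trans _ _ (P C)); last first.
    by apply: le_measure; rewrite ?inE//; exact: compact_borel.
  apply: le_trans (PK _ cC); rewrite -[C]setTI lee_fin limit_mass_setI// mT//.
have [P' P'E] := measure_probability PT.
exists P'; first by move=> U oU; rewrite P'E PU.
move=> D cD; rewrite P'E.
have mD : measurable (D : set (borel x0)) by exact: closed_borel.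
have cDC : compact (D `&` C).
  by apply: (subclosed_compact _ cC) => //; apply: closedI => //;
    exact: compact_closed.
rewrite -limit_mass_setI//; apply: le_trans (PK _ cDC) _.
apply: le_measure; rewrite ?inE//; first exact: compact_borel.
Unshelve. all: end_near. Qed.

Lemma continuous_borel_real (f : T -> R) : continuous f ->
  measurable_fun setT (f : borel x0 -> R).
Proof.
move=> cf.
apply: (measurability _ (RGenOpens.measurableE R)) => _ [_ [a [b ->]] <-].
rewrite setTI; apply: open_borel; apply: (@open_comp T R f).
  by move=> x _; exact: cf.
exact: interval_open.
Qed.

(** One half of the portmanteau theorem. The limit masses of closed sets are bounded by [P], and the
    levels of [f] defined by large inequalities are closed; the layer sums introduce an error of
    [n.+1%:R^-1]. *)
Lemma limit_integral_le (P : probability (borel x0) R) (f : T -> R) (l : R) :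
  (forall D : set T, closed D -> ((m D)%:E <= P D)%E) ->
  continuous f -> (forall x, 0 <= f x <= 1) ->
  (fun p : vague_probability R x0 => \int[p]_x f x) @ G --> l -> l <= \int[P]_x f x.
Proof.
move=> PD cf f01 Gl.
have mf : measurable_fun setT (f : borel x0 -> R).
  exact: continuous_borel_real.
apply/ler_addgt0Pr => e e0.
have [n ne] : exists n : nat, n.+1%:R^-1 < e.
  exists (Num.truncn e^-1); rewrite invf_plt ?posrE//.
  by rewrite -Num.Theory.truncn_lt_nat// invr_ge0 ltW.
pose D (k : nat) := [set x | k.+1%:R <= n.+1%:R * f x].
have cD k : closed (D k).
  apply: (@preimage_closed T R (fun x => n.+1%:R * f x) [set y | k.+1%:R <= y]).
    by move=> x _; apply: cvgM; [exact: cvg_cst|exact: cf].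
  exact: closed_ge.
have Gs : (fun p : vague_probability R x0 => layer_sum p f n.+1) @ G -->
    n.+1%:R^-1 * \sum_(k < n.+1) m (D k).
  apply: cvgM; first exact: cvg_cst.
  apply: (@cvg_big R _ +%R 0 xpredT (@add_continuous R)) => k _.
  by apply: limit_mass_cvg; exact: (@closed_borel T x0 _ (cD k)).
apply: (@le_trans _ _ (n.+1%:R^-1 + n.+1%:R^-1 * \sum_(k < n.+1) m (D k))).
  apply: (ler_cvg_to Gl (cvgD (cvg_cst _) Gs)); near=> p.
  by have /andP[] := @layer_bounds _ _ _ p f n.+1 mf f01 isT.
rewrite addrC; apply: lerD; last exact: ltW.
apply: (@le_trans _ _ (layer_sum P f n.+1)).
  rewrite ler_wpM2l ?invr_ge0//; apply: ler_sum => k _.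
  rewrite -lee_fin -massE; first exact: (PD _ (cD k)).
  exact: (@closed_borel T x0 _ (cD k)).
by have /andP[] := @layer_bounds _ _ _ P f n.+1 mf f01 isT.
Unshelve. all: end_near. Qed.

Lemma continuous_probability_integrable (P : probability (borel x0) R)
    (f : T -> R) (M : R) : continuous f -> (forall x, `|f x| <= M) ->
  P.-integrable setT (EFin \o (f : borel x0 -> R)).
Proof.
move=> cf fM.
exact: (@probability_integrable _ (borel x0) R P f M (continuous_borel_real cf) fM).
Qed.

Lemma Rintegral_probability_affine (P : probability (borel x0) R)
    (f : T -> R) (M a b : R) : continuous f -> (forall x, `|f x| <= M) ->
  \int[P]_x (a * f x + b) = a * \int[P]_x f x + b.
Proof.
move=> cf fM; have i_f := continuous_probability_integrable P cf fM.
have i_af : P.-integrable setT (EFin \o (fun x : borel x0 => a * f x)).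
  apply: (@continuous_probability_integrable P _ (`|a| * M)).
    by move=> x; apply: cvgM; [exact: cvg_cst|exact: cf].
  by move=> x; rewrite normrM ler_wpM2l.
rewrite RintegralD//; last first.
  by apply: (@continuous_probability_integrable P _ `|b|) => // x; exact: cvg_cst.
by rewrite RintegralZl// Rintegral_cst// [X in fine X](probability_setT P) mulr1.
Qed.

(** The one-sided bound applied to [f] and to [1 - f]. *)
Lemma limit_integral_unit (P : probability (borel x0) R) (f : T -> R) :
  (forall D : set T, closed D -> ((m D)%:E <= P D)%E) ->
  continuous f -> (forall x, 0 <= f x <= 1) ->
  (fun p : vague_probability R x0 => \int[p]_x f x) @ G --> \int[P]_x f x.
Proof.
move=> PD cf f01.
have fM x : `|f x| <= 1 by have /andP[f0 f1] := f01 x; rewrite ger0_norm.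
have [l _ Gl] : exists2 l, [set` `[0, 1]] l &
    (fun p : vague_probability R x0 => \int[p]_x f x) @ G --> (l : R).
  apply: ultra_cvg => //; first exact: segment_compact.
  near=> p; rewrite set_itvE /=; apply/andP; split.
    by apply: Rintegral_ge0 => x _; have /andP[] := f01 x.
  have i1 := @continuous_probability_integrable p (cst 1) 1 (@cst_continuous _ _ _)
    (fun=> eq_ind_r (fun z => z <= 1) (lexx 1) (normr1 R)).
  have := @le_Rintegral _ _ _ p setT f (cst 1) measurableT
    (continuous_probability_integrable p cf fM) i1.
  rewrite Rintegral_cst// [X in fine X](probability_setT p) mulr1; apply => x _.
  by have /andP[] := f01 x.
suff <- : l = \int[P]_x f x by [].
apply/eqP; rewrite eq_le (limit_integral_le PD cf f01 Gl) /=.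
pose g x := -1 * f x + 1.
have cg : continuous g.
  move=> x; apply: cvgD; last exact: cvg_cst.
  by apply: cvgM; [exact: cvg_cst|exact: cf].
have g01 x : 0 <= g x <= 1.
  by rewrite /g; have /andP[f0 f1] := f01 x; apply/andP; split; lra.
have Gg : (fun p : vague_probability R x0 => \int[p]_x g x) @ G --> -1 * l + 1.
  rewrite (_ : (fun p : vague_probability R x0 => \int[p]_x g x) =
      fun p : vague_probability R x0 => -1 * (\int[p]_x f x) + 1).
    by apply: cvgD; [apply: cvgM => //; exact: cvg_cst|exact: cvg_cst].
  by apply/funext => p; exact: (Rintegral_probability_affine p (-1) 1 cf fM).
have := limit_integral_le PD cg g01 Gg.
rewrite (Rintegral_probability_affine P (-1) 1 cf fM); lra.
Unshelve. all: end_near. Qed.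

Lemma Cc_bounded (Phi : T -> R) : Cc R T Phi ->
  exists2 M, 0 < M & forall x, `|Phi x| <= M.
Proof.
move=> [cPhi cS].
have cI : compact (Phi @` closure [set x | Phi x != 0]).
  by apply: continuous_compact => //; exact: continuous_subspaceT.
have [M [_ MI]] := compact_bounded cI.
exists (`|M| + 1); first by rewrite ltr_pwDr.
move=> x; have [->|Phix] := eqVneq (Phi x) 0; first by rewrite normr0 addr_ge0.
apply: (MI (`|M| + 1)); first by rewrite (le_lt_trans (ler_norm M))// ltrDl.
by exists x => //; exact: subset_closure.
Qed.

(** The clause on open sets holds because [nu U] is the supremum of the limit masses of the compact
    subsets of [U]. It transfers an almost sure property to the limit when the property itself
    varies along [G], as the pinning time does. *)
Lemma tight_ultra_cvg : exists2 nu : vague_probability R x0, G --> nu &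
  forall U : set T, open U ->
    (forall K : set T, compact K -> K `<=` U ->
      \forall p \near G, (p : probability (borel x0) R) K = 0%E) ->
    nu U = 0%E.
Proof.
have [P PU PD] := tight_limit_exists.
exists P; last first.
  move=> U oU Kz; apply/eqP; rewrite eq_le measure_ge0 andbT PU//.
  apply: inner_content_le => K cK KU; rewrite lee_fin.
  rewrite le_eqVlt; apply/orP; left; apply/eqP.
  apply: (cvg_unique _ (limit_mass_cvg (compact_borel cK))); first exact: Rhausdorff.
  by apply: cvg_near_cst; apply: filterS (Kz K cK KU) => p; rewrite /mass => ->.
apply: (@cvg_initialP _ _ (@vague_eval R T x0)); apply/cvg_sup => -[Phi PhiC].
apply: cvg_initialP.
have cPhi : continuous Phi by case: (set_mem PhiC).
have [M M0 PhiM] := Cc_bounded (set_mem PhiC).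
suff H : (fun p : vague_probability R x0 => \int[p]_x Phi x) @ G --> \int[P]_x Phi x.
  exact: H.
(* This is [(Phi + M) / 2M], with values in [[0, 1]] since [M] bounds [Phi] in absolute value. *)
pose f x := (M *+ 2)^-1 * Phi x + 2^-1.
have cf : continuous f.
  move=> x; apply: cvgD; last exact: cvg_cst.
  by apply: cvgM; [exact: cvg_cst|exact: cPhi].
have f01 x : 0 <= f x <= 1.
  have := PhiM x; rewrite ler_norml => /andP[h1 h2].
  have M20 : 0 < M *+ 2 by rewrite mulrn_wgt0.
  have -> : f x = (M *+ 2)^-1 * (Phi x + M) by rewrite /f; field; rewrite gt_eqF.
  rewrite mulr_ge0 ?invr_ge0 ?(ltW M20)//=; last by lra.
  by rewrite mulrC ler_pdivrMr// mul1r mulr2n; lra.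
have fM x : `|f x| <= 1 by have /andP[f0 f1] := f01 x; rewrite ger0_norm.
have PhiE (p : probability (borel x0) R) :
    \int[p]_x Phi x = (M *+ 2) * \int[p]_x f x + - M.
  rewrite -(Rintegral_probability_affine p (M *+ 2) (- M) cf fM).
  apply: eq_Rintegral => x _; rewrite /f; field.
  by rewrite gt_eqF.
rewrite [X in _ --> X](PhiE P).
rewrite (_ : (fun p : vague_probability R x0 => \int[p]_x Phi x) =
  fun p : vague_probability R x0 => (M *+ 2) * \int[p]_x f x + - M); last first.
  by apply/funext => p; exact: PhiE.
apply: cvgD; last exact: cvg_cst.
by apply: cvgM; [exact: cvg_cst|exact: limit_integral_unit].
Qed.

End tight_ultrafilter.

(** * Markov regularity *)

Lemma vague_integral_continuous (R : realType) (T : topologicalType) (x0 : T)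
    (Phi : T -> R) : Cc R T Phi ->
  continuous (fun p : vague_probability R x0 => \int[p]_x Phi x).
Proof.
move=> PhiC p.
have := @initial_continuous _ _ (@vague_eval R T x0) p.
move=> /(@continuous_comp _ _ _ _
  (fun h : {ptws Cc R T -> R} => h (exist _ Phi (mem_set PhiC)))); apply.
exact: (@proj_continuous (Cc R T) (fun=> R)).
Qed.

Lemma probability_Rintegral_close d (T : measurableType d) (R : realType)
    (p : probability T R) (C : set T) (f g : T -> R) (e : R) :
  measurable C -> p C = 1%E ->
  p.-integrable setT (EFin \o f) -> p.-integrable setT (EFin \o g) ->
  (forall x, C x -> `|f x - g x| <= e) ->
  `|\int[p]_x f x - \int[p]_x g x| <= e.
Proof.
move=> mC pC i_f ig fg.
have nC : p (~` C) = 0%E by rewrite probability_setC// pC subee.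
have IC (h : T -> R) : p.-integrable setT (EFin \o h) ->
    \int[p]_x h x = \int[p]_(x in C) h x.
  move=> ih; rewrite /Rintegral (negligible_integral (N := ~` C))//.
  - by rewrite setTD setCK.
  - exact: measurableC.
have ifC := integrableS measurableT mC (@subsetT _ C) i_f.
have igC := integrableS measurableT mC (@subsetT _ C) ig.
rewrite !IC// -RintegralB//.
have iB : p.-integrable C (EFin \o (fun x => f x - g x)).
  exact: (integrableB mC ifC igC).
rewrite (le_trans (le_normr_Rintegral mC iB))//.
rewrite (@le_trans _ _ (\int[p]_(x in C) e))//; last first.
  by rewrite Rintegral_cst// [X in fine X]pC mulr1.
apply: le_Rintegral => //.
  exact: integrable_norm iB.
apply: measurable_bounded_integrable => //.
  by rewrite [X in (X < _)%E]pC ltry.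
exists `|e|; split; first by rewrite num_real.
by move=> M eM x _; exact: ltW.
Qed.

(** * Translates of pinned measures *)

Section translates.
Context (R : realType) (Y : topologicalGroupType).
Context (Gam : set (paths R Y)) (gam0 : Gam).
Hypotheses (pY : polish R Y) (pG : path_space Gam).
Hypothesis stable : forall y : Y, left_translate y @` Gam = Gam.

Local Notation act := (act stable).

Let hG : hausdorff_space Gam.
Proof. by case: pG => _ _ /polish_hausdorff. Qed.

Let rG : regular_space Gam. Proof. exact: uniform_regular. Qed.

Definition translates (nu : vague_probability R gam0) (x : Y) :
    vague_probability R gam0 :=
  image_probability nu (measurable_act pG stable x).

Definition pinned (I : set R) : set (vague_probability R gam0) :=
  [set nu | exists2 t, I t & nu [set g : Gam | val g t = 1%g] = 1%E].

Definition visits_one (I : set R) : set Gam :=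
  [set g : Gam | exists2 t, I t & val g t = 1%g].

Lemma compact_visits_one I : compact I -> exists2 C : set Gam, compact C &
  visits_one I `<=` C.
Proof.
move=> cI; have [M [_ MI]] := compact_bounded cI.
case: pG => _ _ _ pK _.
exists [set g : Gam | exists2 t, - (M + 1) <= t <= M + 1 & [set 1%g : Y] (val g t)].
  by apply: pK; exact: compact_set1.
move=> g [t It gt]; exists t => //.
by rewrite -ler_norml; apply: (MI (M + 1)) => //; rewrite ltrDl.
Qed.

Lemma pinned_compact_mass I (C : set Gam) nu : compact C -> visits_one I `<=` C ->
  pinned I nu -> nu C = 1%E.
Proof.
move=> cC IC [t It nu1]; apply/eqP; rewrite eq_le.
have mC : measurable (C : set (borel gam0)).
  by apply: closed_borel; exact: compact_closed.
rewrite probability_le1//= -nu1; apply: le_measure; rewrite ?inE//.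
  exact: measurable_eval_eq.
by move=> g gt; apply: IC; exists t.
Qed.

(** The limit of the pinning times along the ultrafilter is a pinning time of the limit measure: a
    compact set of paths that are not at 1 at time [t] receives no mass from measures pinned at
    times close to [t]. *)
Lemma pinned_compact I : compact I -> compact (pinned I).
Proof.
move=> cI; rewrite compact_ultra => G UG GP.
have [C cC IC] := compact_visits_one cI.
have GC : \forall p \near G, (p : probability (borel gam0) R) C = 1%E.
  by apply: filterS GP => p; exact: pinned_compact_mass.
have [nu Gnu nuU] := tight_ultra_cvg hG rG UG cC GC.
exists nu; split => //.
(* The default time 0 is harmless, since [G] contains [pinned I]. *)
have /choice[tau tauP] : forall p : vague_probability R gam0, exists t, pinned I p ->
    I t /\ p [set g : Gam | val g t = 1%g] = 1%E.
  move=> p; have [[t It p1]|np] := pselect (pinned I p); first by exists t.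
  by exists 0.
have [t It Gt] : exists2 t, I t & tau @ G --> (t : R).
  by apply: ultra_cvg => //; apply: filterS GP => p /tauP[].
exists t => //.
have m1 s : measurable ([set g : Gam | val g s = 1%g] : set (borel gam0)).
  exact: measurable_eval_eq.
have oU : open (~` [set g : Gam | val g t = 1%g]).
  exact/closed_openC/(closed_eval_eq pY pG).
rewrite -[X in nu X]setCK probability_setC; last exact: measurableC.
rewrite (nuU _ oU) ?sube0// => K cK KU.
(* Joint continuity of evaluation makes [val g s] avoid 1 for [s] near [t], uniformly over the
   compact [K]. *)
have tK : \forall s \near t, forall g, K g -> val g s != 1%g.
  have /compact_near_coveringP/(_ R (nbhs t) (fun s g => val g s != 1%g)) := cK.
  apply => g Kg.
  have o1 : open (~` [set 1%g : Y]).
    apply/closed_openC/accessible_closed_set1/hausdorff_accessible.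
      exact: (polish_hausdorff pY).
  have [[V W] [/= Vt Wg] VW] : nbhs (t, g) [set p : R * Gam | val p.2 p.1 <> 1%g].
    have n1 : nbhs (val g t) (~` [set 1%g : Y]).
      by apply: open_nbhs_nbhs; split=> //; exact: KU.
    exact: (@path_eval_continuous _ _ _ pG (t, g) _ n1).
  exists (W, V) => // -[g' s] [/= Wg' Vs]; apply/eqP; exact: (VW (s, g')).
have mK : measurable (K : set (borel gam0)).
  by apply: closed_borel; exact: compact_closed.
have := Gt _ tK => GtK; near=> p.
have [Ip p1] : I (tau p) /\ p [set g : Gam | val g (tau p) = 1%g] = 1%E.
  by apply: tauP; near: p.
rewrite -(probability_setI1 mK (m1 _) p1) [X in p X](_ : _ = set0) ?measure0//.
apply/seteqP; split=> // g [Kg g1].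
have : val g (tau p) != 1%g by move: g Kg {g1}; near: p; exact: GtK.
by rewrite g1 eqxx.
Unshelve. all: end_near. Qed.


Lemma Cc_act (Phi : Gam -> R) x : Cc R Gam Phi -> Cc R Gam (Phi \o act x).
Proof.
move=> [cPhi cS]; split.
  by move=> g; apply: continuous_comp; [exact: (act_continuousr pG)|exact: cPhi].
have cI : compact (act x^-1%g @` closure [set g | Phi g != 0]).
  apply: continuous_compact => //; apply: continuous_subspaceT.
  exact: (act_continuousr pG).
apply: (subclosed_compact _ cI); first exact: closed_closure.
have /closure_id -> := compact_closed hG cI.
apply: closureS => g /= Pg; exists (act x g); first exact: subset_closure.
by rewrite -actM mulVg act1.
Qed.

Lemma translates_integral (nu : vague_probability R gam0) x (Phi : Gam -> R) :
  Cc R Gam Phi ->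
  \int[translates nu x]_g Phi g = \int[nu]_g (Phi \o act x) g.
Proof.
move=> PhiC; have [M _ PhiM] := Cc_bounded PhiC; have [cPhi _] := PhiC.
have [cPhix _] := Cc_act x PhiC.
rewrite /Rintegral; congr fine.
have := @integral_pushforward _ _ _ _ R _ (measurable_act pG stable x :
  measurable_fun setT (_ : borel gam0 -> borel gam0)) nu setT (EFin \o Phi).
rewrite preimage_setT; apply => //.
  by apply/measurable_EFinP; exact: continuous_borel_real.
by apply: (continuous_probability_integrable nu cPhix) => g; exact: PhiM.
Qed.

(** Vague convergence of [nu'] deals with the fixed test function [Phi \o act x]. Replacing [act x]
    by [act x'] costs little uniformly on the compact [C], which carries every measure of
    [pinned I]; hence the restriction of the filter to this set. *)
Lemma translates_cvg I nu x : compact I -> pinned I nu ->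
  (fun p => translates p.2 p.1) @ (filter_prod (nbhs x) (within (pinned I) (nbhs nu)))
    --> translates nu x.
Proof.
move=> cI Pnu; have [C cC IC] := compact_visits_one cI.
have mC : measurable (C : set (borel gam0)).
  by apply: closed_borel; exact: compact_closed.
apply: (@cvg_initialP _ _ (@vague_eval R Gam gam0)); apply/cvg_sup => -[Phi PhiC].
apply: cvg_initialP.
have PC : Cc R Gam Phi := set_mem PhiC; have [cPhi _] := PC.
suff H : (fun p : Y * vague_probability R gam0 => \int[translates p.2 p.1]_g Phi g) @
    (filter_prod (nbhs x) (within (pinned I) (nbhs nu))) -->
    \int[translates nu x]_g Phi g by exact: H.
apply/cvgrPdist_le => e e0.
have [M _ PhiM] := Cc_bounded PC.
have Phix y := Cc_act y PC.
have e20 : 0 < e / 2 by rewrite divr_gt0.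
have Nx : \forall x' \near x, forall g, C g ->
    `|Phi (act x g) - Phi (act x' g)| < e / 2.
  apply: (@compact_uniform_near _ R _ _ C (fun x' g => Phi (act x' g))
    (fun g => Phi (act x g)) [set p | `|p.1 - p.2| < e / 2]) => //.
  - exact: entourage_ball (PosNum e20).
  - by move=> g _; have [+ _] := Phix x; exact.
  - move=> g _; apply: (@continuous_comp _ _ _
      (fun p : Gam * Y => act p.2 p.1) Phi (g, x)).
      have ac := @act_continuous _ _ _ pG stable.
      exact: (@continuous_at_comp2 _ _ _ _ snd fst act (g, x) ac
        (@cvg_snd _ _ _ _ _) (@cvg_fst _ _ _ _ _)).
    exact: cPhi.
have Nnu : \forall nu' \near nu, `|\int[nu]_g (Phi \o act x) g -
    \int[(nu' : vague_probability R gam0)]_g (Phi \o act x) g| < e / 2.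
  have /cvgrPdist_lt := @vague_integral_continuous R Gam gam0 _ (Phix x) nu.
  exact.
exists ([set x' | forall g, C g -> `|Phi (act x g) - Phi (act x' g)| < e / 2],
  pinned I `&` [set nu' : vague_probability R gam0 |
    `|\int[nu]_g (Phi \o act x) g - \int[nu']_g (Phi \o act x) g| < e / 2]).
  split => //=; apply: filterI; last exact: cvg_within Nnu.
  exact: withinT.
move=> [x' nu'] [/= hx' [Pnu' hnu']].
rewrite !translates_integral//.
have I1 y : nu'.-integrable setT (EFin \o (Phi \o act y : borel gam0 -> R)).
  apply: (@continuous_probability_integrable R Gam gam0 nu' _ M).
    by case: (Phix y).
  by move=> g; exact: PhiM.
rewrite (le_trans (ler_distD (\int[nu']_g (Phi \o act x) g) _ _))//.
rewrite [leRHS]splitr lerD ?(ltW hnu')//.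
apply: (@probability_Rintegral_close _ _ _ nu' C) => //.
- exact: pinned_compact_mass Pnu'.
- by move=> g Cg; exact/ltW/hx'.
Qed.

Lemma translates_continuous I nu : compact I -> pinned I nu ->
  continuous (translates nu).
Proof.
move=> cI Pnu x A nA.
have [[U V] [/= Ux Vnu] UV] := @translates_cvg I nu x cI Pnu A nA.
have Vnu' : nbhs nu (fun p => pinned I p -> V p) := Vnu.
apply: filterS Ux => x' Ux'; apply: (UV (x', nu)); split=> //=.
exact: (nbhs_singleton Vnu') Pnu.
Qed.

Variable mu : {measure set (borel (1%g : Y)) -> \bar R}.

Lemma translates_within_continuous I : compact I ->
  {within pinned I, continuous (translates : _ -> mu_family mu gam0)}.
Proof.
move=> cI; apply/subspace_continuousP => nu Pnu.
apply/fam_cvgP => L [_ cL] A /uniform_nbhs[E [eE EA]].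
have FF : Filter (within (pinned I) (nbhs nu)) by exact: within_filter.
have := @compact_uniform_near Y _ _ (within (pinned I) (nbhs nu)) L
  translates (translates nu) E FF cL eE.
move=> H; suff K : \forall nu' \near within (pinned I) (nbhs nu),
    forall x, L x -> E (translates nu x, translates nu' x).
  by apply: filterS K => nu' K; exact: EA.
apply: H => x _; first exact: (translates_continuous cI Pnu).
exact: translates_cvg.
Qed.

Lemma translates_Xmu I nu : compact I -> pinned I nu ->
  Xmu (translates nu : mu_family mu gam0).
Proof.
move=> cI Pnu; split.
  exact: (continuous_subspaceT (translates_continuous cI Pnu)).
have [t It nu1] := Pnu; exists t => x _ g xg; apply: contrapT => gx.
have oU : open (~` [set g : Gam | val g t = x]).
  exact/closed_openC/(closed_eval_eq pY pG).
have := xg _ oU gx; apply/negP; rewrite -leNgt le_eqVlt; apply/orP; left; apply/eqP.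
rewrite [LHS](@probability_setC _ _ _ (translates nu x)).
  rewrite (_ : translates nu x _ = 1%E) ?subee//.
  exact: translate_probability.
exact: measurable_eval_eq.
Qed.

End translates.

Section left_case.
Context (R : realType) (Y : topologicalGroupType).
Variable mu : {measure set (borel (1%g : Y)) -> \bar R}.
Context (Gam : set (paths R Y)) (gam0 : Gam).
Hypotheses (lcY : locally_compact [set: Y]) (pY : polish R Y).
Hypotheses (mu_haar : left_haar mu) (pG : path_space Gam).
Hypothesis stable : forall y : Y, left_translate y @` Gam = Gam.
Implicit Types eta : {measure set (borel gam0) -> \bar R}.

Lemma markovianisations_invariant (F : {fset R}) eta :
  invariant_marginals mu stable eta ->
  invariant_marginals mu stable (markovianisations mu F eta).
Proof.
rewrite /markovianisations; elim: (enum_fset F) eta => //= t s IH eta ieta.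
(* Where no Markovianisation exists, the map returns its argument, which is invariant by
   assumption. *)
apply: IH; rewrite /markovianisation; case: pselect => // ex.
exact: (is_markovianisation_invariant lcY pY mu_haar pG ieta (projT2 (cid ex))).
Qed.

(** The compact set of families depends on [I] alone: changing [F] or [t] in [I] only changes the
    measure [nu] within [pinned I]. *)
Lemma invariant_markov_regular eta :
  invariant_marginals mu stable eta -> markov_regular mu eta.
Proof.
move=> ieta I cI; pose J := translates pG stable : _ -> mu_family mu gam0.
exists (J @` @pinned R Y Gam gam0 I); split.
- apply: continuous_compact; last exact: pinned_compact.
  exact: translates_within_continuous.
- by move=> _ [nu Pnu <-]; exact: translates_Xmu Pnu.
move=> F t It.
have [nu [nu1 nuE]] := invariant_marginals_disintegration lcY pY mu_haar pG t
  (markovianisations_invariant F ieta).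
exists (J nu); first by exists nu => //; exists t.
have sT := msupp_haar pY mu_haar; split.
- by move=> A mA; rewrite sT; exact: measurable_translate.
- by move=> x _; exact: translate_probability.
- by move=> A mA; rewrite sT nuE.
Qed.

End left_case.

Theorem theorem1p4 (R : realType) (Y : topologicalGroupType)
    (mu : {measure set (borel (1%g : Y)) -> \bar R})
    (Gam : set (paths R Y)) (gam0 : Gam)
    (eta : {measure set (borel gam0) -> \bar R}) :
  locally_compact [set: Y] -> polish R Y -> path_space Gam ->
  Mmu mu eta ->
  (left_haar mu ->
   forall stable : forall y : Y, left_translate y @` Gam = Gam,
   (forall y : Y, invariant_measure eta (induced_map (stable y))) ->
   markov_regular mu eta) /\
  (right_haar mu ->
   forall stable : forall y : Y, right_translate y @` Gam = Gam,
   (forall y : Y, invariant_measure eta (induced_map (stable y))) ->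
   markov_regular mu eta).
Proof.
move=> lcY pY pG [_ marg]; split=> haar stable inv.
  exact: (invariant_markov_regular lcY pY haar pG (conj inv marg)).
exact: (@invariant_markov_regular R (opposite Y) mu Gam gam0 lcY pY haar pG stable
  eta (conj inv marg)).
Qed.
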